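(* Let $\mathcal L$ be a (real) second order ordinary differential operator on $[0,L]$ with separated boundary conditions, with Evans function $E$ and weight $W$ as defined in the context. Then for every $\lambda\in\sigma(\mathcal L)$, $$\frac{d}{d\lambda}\,\frac{E(\lambda)}{W(\lambda)}=\pm1,$$ i.e. the derivative of $E/W$ at $\lambda$ exists and equals $1$ or $-1$.
   Context: Setting. Let $L>0$, $\epsilon\in\{1,-1\}$, and let $A_0:[0,L]\to M_{2\times 2}(\mathbb R)$ be smooth with $\operatorname{tr}A_0(x)=0$ for all $x$ (so that the Wronskian of two solutions is constant). Let $e_1,e_2$ be the standard basis column vectors. The operator $\mathcal L$ on $L_2(0,L)$ is the second order differential operator given by: $y\in \mathrm{dom}(\mathcal L)$ and $\mathcal L y=g$ ($g\in L_2(0,L)$) if and only if there is an absolutely continuous $u$ on $[0,L]$ with values in $\mathbb C^2$ such that $u_1=y$, $u'=A_0(x)u+\epsilon\, g\,e_2$, and $B_Lu(0)=0$, $B_Ru(L)=0$, where $B_L,B_R$ are real $1\times2$ matrices with $B_LB_L^T=B_RB_R^T=1$. It is assumed that $u$ is uniquely determined by $y=u_1$ (as for $u=(y,y')$ or quasi-derivatives), so $\mathcal L$ is well defined. Thus $(\mathcal L-\lambda)y=f$ is equivalent to $u'=A(x,\lambda)u+\epsilon f e_2$ with $A(x,\lambda)=A_0(x)+\epsilon\lambda\, e_2e_1^T$. It is assumed that $\mathcal L$ has compact resolvent. (For such real data the spectrum is real; $E$ and $W$ are considered as functions of real $\lambda$.) The spectrum $\sigma(\mathcal L)$ is the complement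 of the set of $\lambda\in\mathbb C$ for which $(\mathcal L-\lambda)^{-1}$ exists as a bounded operator on $L_2(0,L)$. Let $U(x)=U(x;\lambda)$ be the fundamental matrix, $U'=A(x,\lambda)U$, $U(0)=I$, and $M=M(\lambda)=U(L;\lambda)$. Let $N_L$ be a fixed ($\lambda$-independent) real nonzero $2\times1$ matrix spanning the null space of $B_L$. Set $E(\lambda)=B_RMN_L$ (a scalar), $P(\lambda)=N_LB_RM$, $$\mathcal G(x,y,\lambda)=\begin{cases}U(x)(E(\lambda)I-P)U^{-1}(y), & y<x,\\ -U(x)PU^{-1}(y), & y>x,\end{cases}$$ $G(x,y,\lambda)=[\mathcal G(x,y,\lambda)]_{12}$, and $W(\lambda)=\left(\int_0^L\int_0^LG(x,y,\lambda)^2\,dy\,dx\right)^{1/2}$. *)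

(* Defs.v *)
From HB Require Import structures.
From mathcomp Require Import all_boot all_order all_algebra.
From mathcomp Require Import all_classical all_reals all_analysis.
From mathcomp Require Export complex.

Set Implicit Arguments.
Unset Strict Implicit.
Unset Printing Implicit Defensive.

Import Order.TTheory GRing.Theory Num.Theory.
Import numFieldNormedType.Exports.

Local Open Scope classical_set_scope.
Local Open Scope complex_scope.
Local Open Scope ring_scope.

Section Calculus.
Variable R : realType.

(* Derivative relative to D: one-sided at the endpoints when D is a segment. *)
Definition has_deriv_in (V : normedModType R) (D : set R) (f : R -> V)
    (x : R) (l : V) : Prop :=
  (fun t : R => (t - x)^-1 *: (f t - f x)) @ within D x^' --> l.

Definition smooth_in (V : normedModType R) (D : set R) (f : R -> V) : Prop :=
  exists F : nat -> R -> V,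
    (forall x, D x -> F 0%N x = f x) /\
    (forall n x, D x -> has_deriv_in D (F n) x (F n.+1 x)).

Definition has_cderiv_in (D : set R) (u : R -> 'cV[R[i]]_2) (x : R)
    (v : 'cV[R[i]]_2) : Prop :=
  has_deriv_in D (fun t => map_mx (@complex.Re R) (u t)) x
    (map_mx (@complex.Re R) v) /\
  has_deriv_in D (fun t => map_mx (@complex.Im R) (u t)) x
    (map_mx (@complex.Im R) v).

Definition abs_continuous (a b : R) (f : R -> R[i]) : Prop :=
  forall e : R, 0 < e -> exists2 d : R, 0 < d &
    forall (n : nat) (s t : 'I_n -> R),
      (forall k, [/\ a <= s k, s k <= t k & t k <= b]) ->
      trivIset setT (fun k => `]s k, t k[%classic) ->
      \sum_(k < n) (t k - s k) < d ->
      \sum_(k < n) ComplexField.Normc.normc (f (t k) - f (s k)) < e.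

Definition to_cmx (m n : nat) (B : 'M[R]_(m, n)) : 'M[R[i]]_(m, n) :=
  map_mx (real_complex R) B.

End Calculus.

(* Elements of the complex space L_2(0,len) are represented by functions on R,
   of which only the values on [0,len] matter, up to equality a.e. there. *)
Section L2.
Variables (R : realType) (len : R).
Implicit Types f g : R -> R[i].
Notation mu := (@lebesgue_measure R).

Definition eqae f g : Prop := {ae mu, forall x, x \in `[0, len] -> f x = g x}.

Definition inL2 f : Prop :=
  [/\ measurable_fun `[0, len] (fun x => complex.Re (f x)),
      measurable_fun `[0, len] (fun x => complex.Im (f x)) &
      (\int[mu]_(x in `[0%R, len]) (ComplexField.Normc.normc (f x) ^+ 2)%:E < +oo)%E].

Definition L2norm f : R :=
  Num.sqrt (\int[mu]_(x in `[0, len]) (ComplexField.Normc.normc (f x) ^+ 2)).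

Definition bounded_operator (T : (R -> R[i]) -> (R -> R[i])) : Prop :=
  [/\ forall f, inL2 f -> inL2 (T f),
      forall f g, inL2 f -> inL2 g -> eqae f g -> eqae (T f) (T g),
      forall (a : R[i]) f g, inL2 f -> inL2 g ->
        eqae (T (fun x => a * f x + g x)) (fun x => a * T f x + T g x) &
      exists C : R, forall f, inL2 f -> L2norm (T f) <= C * L2norm f].

Definition compact_operator (T : (R -> R[i]) -> (R -> R[i])) : Prop :=
  bounded_operator T /\
  forall f_ : nat -> R -> R[i],
    (forall n, inL2 (f_ n)) ->
    (exists C : R, forall n, L2norm (f_ n) <= C) ->
    exists (k : nat -> nat) (g : R -> R[i]),
      [/\ {homo k : i j / (i < j)%N}, inL2 g &
          (fun n => L2norm (fun x => T (f_ (k n)) x - g x)) @ \oo --> (0 : R)].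

End L2.

Section Operator.
Variables (R : realType) (len eps : R) (A0 : R -> 'M[R]_2) (BL BR : 'rV[R]_2).
Notation mu := (@lebesgue_measure R).

(* The standard basis e_1, e_2 of column vectors is delta_mx 0 0, delta_mx 1 0. *)

(* u is a vector function witnessing that y is in dom(L) and L y = g. *)
Definition operator_witness (y g : R -> R[i]) (u : R -> 'cV[R[i]]_2) : Prop :=
  [/\ forall k : 'I_2, abs_continuous 0 len (fun x => u x k 0),
      eqae len (fun x => u x 0 0) y,
      {ae mu, forall x, x \in `[0, len] ->
        has_cderiv_in `[0, len] u x
          (to_cmx (A0 x) *m u x + (eps%:C * g x) *: delta_mx 1 0)},
      to_cmx BL *m u 0 = 0 &
      to_cmx BR *m u len = 0].

(* The graph of the operator: y is in dom(L) and L y = g. *)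
Definition operator_graph (y g : R -> R[i]) : Prop :=
  [/\ inL2 len y, inL2 len g & exists u, operator_witness y g u].

Definition witness_unique : Prop :=
  forall y g g' u u', inL2 len y -> inL2 len g -> inL2 len g' ->
    operator_witness y g u -> operator_witness y g' u' ->
    forall x, x \in `[0, len] -> u x = u' x.

(* T is (L - z)^-1, as a bounded operator on the whole of L_2(0,len). *)
Definition is_resolvent (z : R[i]) (T : (R -> R[i]) -> (R -> R[i])) : Prop :=
  [/\ bounded_operator len T,
      forall f, inL2 len f -> operator_graph (T f) (fun x => f x + z * T f x) &
      forall y g, operator_graph y g -> eqae len (T (fun x => g x - z * y x)) y].

Definition operator_spectrum : set R[i] :=
  [set z | ~ exists T, is_resolvent z T].

Definition has_compact_resolvent : Prop :=
  exists (z : R[i]) (T : (R -> R[i]) -> (R -> R[i])),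
    is_resolvent z T /\ compact_operator len T.

Definition system_matrix (x l : R) : 'M[R]_2 :=
  A0 x + (eps * l) *: (delta_mx 1 0 *m (delta_mx 0 0 : 'cV[R]_2)^T).

(* U x l stands for U(x;l). *)
Definition fundamental_matrix (U : R -> R -> 'M[R]_2) : Prop :=
  forall l : R, U 0 l = 1%:M /\
    forall x, x \in `[0, len] ->
      has_deriv_in `[0, len] (fun t => U t l) x (system_matrix x l *m U x l).

End Operator.

Section Evans.
Variables (R : realType) (len : R) (BR : 'rV[R]_2) (NL : 'cV[R]_2).
Variable U : R -> R -> 'M[R]_2.
Notation mu := (@lebesgue_measure R).

Definition monodromy (l : R) : 'M[R]_2 := U len l.

Definition Evans (l : R) : R := (BR *m monodromy l *m NL) 0 0.

Definition Pmx (l : R) : 'M[R]_2 := NL *m BR *m monodromy l.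

(* The value on the diagonal x = y, left open by the mathematical definition,
   plays no role in the integral defining the weight. *)
Definition Gmx (x y l : R) : 'M[R]_2 :=
  if y < x then U x l *m ((Evans l)%:M - Pmx l) *m invmx (U y l)
  else - (U x l *m Pmx l *m invmx (U y l)).

Definition Green (x y l : R) : R := Gmx x y l 0 1.

Definition weight (l : R) : R :=
  Num.sqrt (\int[mu]_(x in `[0, len]) \int[mu]_(y in `[0, len])
              (Green x y l) ^+ 2).

End Evans.

(* Main.v *)
Require Import Defs.
From HB Require Import structures.
From mathcomp Require Import all_boot all_order all_algebra.
From mathcomp Require Import all_classical all_reals all_analysis.
From mathcomp Require Import measurable_realfun.
From mathcomp Require Import ring lra.
Import Order.TTheory GRing.Theory Num.Theory.
Import numFieldNormedType.Exports.
Local Open Scope classical_set_scope.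
Local Open Scope complex_scope.
Local Open Scope ring_scope.

Set Implicit Arguments.
Unset Strict Implicit.
Unset Printing Implicit Defensive.

(** Let E be the Evans function and W the weight, and let l be a real point of
the spectrum.

_The spectrum is contained in the zero set of E_ (spectrum_Evans_eq0). If
E(l) <> 0, variation of constants gives, for every square integrable f, an
absolutely continuous solution of u' = A u + eps f e2 with both boundary
conditions, namely
  u = eps U(x) (q(x) - P q(L) / E),   q(x) = int_0^x U^-1 e2 f.
The map from f to the first component of u is bounded on L_2 and is the inverse
of the operator minus l. The solution is unique because U^-1 d is absolutely
continuous with zero derivative almost everywhere whenever d solves the
homogeneous system, hence is constant (abs_cont_ae_rderiv0), so that the
boundary conditions force d = 0. Real and imaginary parts are treated separately,
since the system is real.

_The slope of E at a zero._ Put phi(y) = (U(y) N_L)_1 and let w(y) be the second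
entry of the row B_R M U^-1(y). Integrating the derivative of
U(y; l)^-1 U(y; m) gives the exact identity (Evans_sub)
  E(m) - E(l) = (m - l) eps int w(y; l) phi(y; m) dy,
and U depends continuously on the parameter, uniformly in x
(U_lipschitz_param). Hence E'(l) = eps int w phi. When E(l) = 0 the row B_R M
is orthogonal to N_L, and as det U = 1 this gives w = c phi for a constant
c <> 0 (wrow_proportional); thus E'(l) = eps c int phi^2.

_The weight at a zero._ In general G(x, y) = [y < x] E k(x, y) - phi(x) w(y) with
k(x, y) = (U(x) U^-1(y))_12 (GreenE). When E(l) = 0 this is - c phi(x) phi(y),
so W(l) = |c| int phi^2. This is nonzero: if phi vanished almost everywhere then
U N_L would be a nonzero witness that the operator maps the zero function to
zero, against the uniqueness of witnesses (energy_gt0). The weight is continuous at l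
because G is uniformly continuous in the parameter (weight_cvg).

Finally E(m) / W(m) = (m - l) S(m) / W(m), where S / W is continuous at l with
S(l) / W(l) = eps c / |c|, which is 1 or -1. *)

(** * Derivatives relative to a segment *)

Section RelativeDerivative.
Variables (R : realType) (a b : R).
Implicit Types (f g : R -> R) (x y l : R).

(** The real-valued case of [has_deriv_in] for the segment [a, b]: one-sided at
the endpoints. *)
Definition rderiv f x l : Prop :=
  (fun t => (t - x)^-1 * (f t - f x)) @ within `[a, b] x^' --> l.

(** First-order expansion; this form also covers t = x. *)
Lemma rderivP f x l : rderiv f x l <->
  forall e, 0 < e -> \forall t \near x, t \in `[a, b] ->
    `|f t - f x - l * (t - x)| <= e * `|t - x|.
Proof.
split.
- move=> /cvgrPdist_le h e e0.
  have := h _ e0.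
  rewrite near_withinE /dnbhs near_withinE => H.
  near=> t => tab.
  have [->|tx] := eqVneq t x; first by rewrite !subrr mulr0 subr0 normr0 mulr0.
  have tx0 : t - x != 0 by rewrite subr_eq0.
  have : `|l - (t - x)^-1 * (f t - f x)| <= e by move: tab; move: tx; near: t; apply: filterS H => t; apply.
  rewrite -(ler_pM2r (x := `|t - x|)) ?normr_gt0//.
  rewrite -normrM distrC.
  suff -> : (l - (t - x)^-1 * (f t - f x)) * (t - x) = - (f t - f x - l * (t - x)).
    by rewrite normrN distrC.
  by field.
- move=> h; apply/cvgrPdist_le => e e0.
  rewrite near_withinE /dnbhs near_withinE.
  have H := h _ e0.
  near=> t => tx tab.
  have tx0 : t - x != 0 by rewrite subr_eq0.
  rewrite -(ler_pM2r (x := `|t - x|)) ?normr_gt0//.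
  rewrite -normrM.
  have -> : (l - (t - x)^-1 * (f t - f x)) * (t - x) = - (f t - f x - l * (t - x)).
    by field.
  by rewrite normrN; move: tab; near: t; exact: H.
Unshelve. all: by end_near. Qed.

Lemma rderiv_cvg_nbhs f x l : rderiv f x l ->
  f t @[t --> within `[a, b] (nbhs x)] --> f x.
Proof.
move=> /rderivP h; apply/cvgrPdist_le => e e0.
have H := h _ (ltr01 : 0 < (1 : R)).
have k0 : 0 < `|l| + 1 by rewrite ltr_pwDr.
have d0 : 0 < e / (`|l| + 1) by rewrite divr_gt0.
rewrite near_withinE; near=> t => tab.
rewrite distrC -(subrK (l * (t - x)) (f t - f x)).
apply: le_trans (ler_normD _ _) _.
have h1 : `|f t - f x - l * (t - x)| <= 1 * `|t - x|.
  by move: tab; near: t; exact: H.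
have h2 : `|t - x| <= e / (`|l| + 1).
  near: t; apply/nbhs_ballP; exists (e / (`|l| + 1)) => //= t.
  by rewrite /ball/= distrC => /ltW.
rewrite normrM; apply: le_trans (lerD h1 (lexx _)) _.
by rewrite -mulrDl addrC mulrC -ler_pdivlMr.
Unshelve. all: by end_near. Qed.

Lemma rderiv_cvg f x l : rderiv f x l -> f t @[t --> within `[a, b] x^'] --> f x.
Proof.
move=> /rderiv_cvg_nbhs h; apply: cvg_trans h; apply: cvg_fmap2 => A.
by rewrite /within/= /dnbhs /within/= => hA; apply: filterS hA => t hh _.
Qed.

Lemma rderiv_cst c x : rderiv (fun=> c) x 0.
Proof.
rewrite /rderiv; under eq_fun do rewrite subrr mulr0.
exact: cvg_cst.
Qed.

Lemma rderivD f g x l m : rderiv f x l -> rderiv g x m ->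
  rderiv (fun t => f t + g t) x (l + m).
Proof.
move=> hf hg; apply: cvg_trans (cvgD hf hg); apply: near_eq_cvg.
by apply: nearW => t; rewrite !fctE/=; ring.
Qed.

Lemma rderivN f x l : rderiv f x l -> rderiv (fun t => - f t) x (- l).
Proof.
move=> hf; apply: cvg_trans (cvgN hf); apply: near_eq_cvg.
by apply: nearW => t; rewrite !fctE/=; ring.
Qed.

Lemma rderivB f g x l m : rderiv f x l -> rderiv g x m ->
  rderiv (fun t => f t - g t) x (l - m).
Proof. by move=> hf hg; apply: rderivD => //; exact: rderivN. Qed.

Lemma rderivM f g x l m : rderiv f x l -> rderiv g x m ->
  rderiv (fun t => f t * g t) x (l * g x + f x * m).
Proof.
move=> hf hg; have cf := rderiv_cvg hf.
apply: cvg_trans (cvgD (cvgM hf (cvg_cst (g x))) (cvgM cf hg)).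
by apply: near_eq_cvg; apply: nearW => t; rewrite !fctE/=; ring.
Qed.

Lemma rderivZ c f x l : rderiv f x l -> rderiv (fun t => c * f t) x (c * l).
Proof.
move=> hf; have := rderivM (rderiv_cst c x) hf.
by rewrite mul0r add0r.
Qed.

Lemma is_derive_rderiv f x l : is_derive x 1 f l -> rderiv f x l.
Proof.
move=> [df <-].
apply/rderivP => e e0.
have /cvgrPdist_le /(_ _ e0) := df.
rewrite /dnbhs near_withinE -/(derive f x 1) => /nbhs_ballP[d /= d0 H].
near=> t => _.
have [->|tx] := eqVneq t x; first by rewrite !subrr mulr0 subr0 normr0 mulr0.
have tx0 : t - x != 0 by rewrite subr_eq0.
have /= := H (t - x); rewrite /ball/= sub0r normrN.
rewrite /(_ *: _)/= mulr1 subrK => /(_ _ tx0) K.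
rewrite -(ler_pM2r (x := `|t - x|)) ?normr_gt0// in K.
have : `|t - x| < d.
  by near: t; apply/nbhs_ballP; exists d => //= t; rewrite /ball/= distrC.
move=> /K; rewrite -normrM; apply: le_trans.
rewrite -normrN le_eqVlt; apply/orP; left; apply/eqP; congr (`|_|); field.
by [].
Unshelve. all: by end_near. Qed.

Lemma rderiv_is_derive f x l : x \in `]a, b[ -> rderiv f x l -> is_derive x 1 f l.
Proof.
move=> xab /rderivP h.
suff K : (h0^-1 *: (f (h0 *: 1 + x) - f x)) @[h0 --> 0^'] --> l.
  by split; [apply/cvg_ex; exists l|apply/cvg_lim].
apply/cvgrPdist_le => e e0.
have H := h _ e0.
have xo : \forall t \near x, t \in `[a, b].
  have : \forall t \near x, t \in `]a, b[ by exact: near_in_itvoo.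
  by apply: filterS => t; apply: subset_itv_oo_cc.
have /nbhs_ballP[d /= d0 Hd] : \forall t \near x, `|f t - f x - l * (t - x)| <= e * `|t - x|.
  near=> t.
  have tI : t \in `[a, b] by near: t; exact: xo.
  by move: tI; near: t; exact: H.
rewrite /dnbhs near_withinE.
apply/nbhs_ballP; exists d => //= t; rewrite /ball/= sub0r normrN => td t0.
rewrite /(_ *: _)/= mulr1.
have := Hd (t + x); rewrite /ball/= opprD addrCA subrr addr0 normrN => /(_ td).
rewrite addrK => K.
rewrite -(ler_pM2r (x := `|t|)) ?normr_gt0//.
apply: le_trans K; rewrite -normrM -normrN le_eqVlt; apply/orP; left; apply/eqP.
by congr (`|_|); field.
Unshelve. all: by end_near. Qed.

Lemma rderiv_continuous f (f' : R -> R) :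
  (forall x, x \in `[a, b] -> rderiv f x (f' x)) -> {within `[a, b], continuous f}.
Proof.
move=> h; apply/subspace_continuousP => x xab.
exact: (rderiv_cvg_nbhs (h x xab)).
Qed.

Lemma rderiv_lipschitz f (f' : R -> R) (K : R) :
  (forall x, x \in `[a, b] -> rderiv f x (f' x)) ->
  (forall x, x \in `[a, b] -> `|f' x| <= K) ->
  forall x y, x \in `[a, b] -> y \in `[a, b] -> `|f x - f y| <= K * `|x - y|.
Proof.
move=> h hK.
have main x y : x \in `[a, b] -> y \in `[a, b] -> x < y ->
    `|f y - f x| <= K * (y - x).
  move=> xab yab xy.
  have sub : {subset `[x, y] <= `[a, b]}.
    move: xab yab; rewrite !in_itv/= => /andP[ax xb] /andP[ay yb] t.
    by rewrite !in_itv/= => /andP[xt ty]; rewrite (le_trans ax)//= (le_trans ty).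
  have subo : {subset `]x, y[ <= `]a, b[}.
    move: xab yab; rewrite !in_itv/= => /andP[ax xb] /andP[ay yb] t.
    by rewrite !in_itv/= => /andP[xt ty]; rewrite (le_lt_trans ax)//= (lt_le_trans ty).
  have [t txy ->] := MVT xy (fun t txy => rderiv_is_derive (subo _ txy) (h _ (sub _ (subset_itv_oo_cc txy))))
     (continuous_subspaceW (fun t => sub t) (rderiv_continuous h)).
  rewrite normrM (gtr0_norm (x := y - x)) ?subr_gt0//.
  by rewrite ler_wpM2r ?subr_ge0 ?(ltW xy)// hK// sub//; apply: subset_itv_oo_cc.
move=> x y xab yab.
have [xy|yx|->] := ltgtP x y; last by rewrite !subrr normr0 mulr0.
- by rewrite distrC (distrC x) (gtr0_norm (x := y - x)) ?subr_gt0//; apply: main.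
- by rewrite (gtr0_norm (x := x - y)) ?subr_gt0//; apply: main.
Qed.

Lemma rderiv0_cst f : (forall x, x \in `[a, b] -> rderiv f x 0) ->
  forall x y, x \in `[a, b] -> y \in `[a, b] -> f x = f y.
Proof.
move=> h x y xab yab; apply/eqP; rewrite -subr_eq0 -normr_le0.
rewrite -[leRHS](mul0r `|x - y|).
apply: (@rderiv_lipschitz f (fun=> 0)) => // t _.
by rewrite normr0.
Qed.

Lemma rderiv_FTC2 f (f' : R -> R) : a < b ->
  (forall x, x \in `[a, b] -> rderiv f x (f' x)) ->
  {within `[a, b], continuous f'} ->
  \int[lebesgue_measure]_(x in `[a, b]) f' x = f b - f a.
Proof.
move=> ab h cf'.
rewrite /Rintegral (@continuous_FTC2 _ f' f a b) //.
- have /continuous_within_itvP -/(_ ab) [_ fa fb] := rderiv_continuous h.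
  split => // x xab.
  have := rderiv_is_derive xab (h _ (subset_itv_oo_cc xab)).
  by case.
- move=> x xab; rewrite derive1E.
  have := rderiv_is_derive xab (h _ (subset_itv_oo_cc xab)).
  by case.
Qed.

End RelativeDerivative.

(** Matrix-valued derivatives are entrywise. *)
Lemma has_deriv_in_mxP (R : realType) (a b : R) (m n : nat)
    (u : R -> 'M[R]_(m, n)) (x : R) (v : 'M[R]_(m, n)) :
  has_deriv_in `[a, b] u x v <->
  forall i j, rderiv a b (fun t => u t i j) x (v i j).
Proof.
split.
- move=> h i j; apply/cvgrPdist_le => e e0.
  have /cvgrPdist_le/(_ _ e0) := h; apply: filterS => t; apply: le_trans.
  rewrite [leRHS]/Num.Def.normr/= mx_normrE.
  apply: le_trans (le_bigmax _ _ (i, j)).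
  by rewrite !mxE.
- move=> h; apply/cvgrPdist_le => e e0.
  have H i j : \forall t \near within `[a, b] x^',
      `|v i j - (t - x)^-1 * (u t i j - u x i j)| <= e.
    by have /cvgrPdist_le/(_ _ e0) := h i j.
  have : \forall t \near within `[a, b] x^', forall i j,
      `|v i j - (t - x)^-1 * (u t i j - u x i j)| <= e.
    by apply: filter_forall => i; apply: filter_forall => j.
  apply: filterS => t ht.
  rewrite [leLHS]/Num.Def.normr/= mx_normrE (bigmax_le _ (ltW e0))//= => -[i j] _ /=.
  by rewrite !mxE; exact: ht.
Qed.

(** * Absolutely continuous functions *)

Section AbsolutelyContinuous.
Variables (R : realType) (a b : R).
Notation mu := (@lebesgue_measure R).
Implicit Types (f g : R -> R).

(** The real-valued case of [abs_continuous]. *)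
Definition abs_cont f : Prop :=
  forall e : R, 0 < e -> exists2 d : R, 0 < d &
    forall (n : nat) (s t : 'I_n -> R),
      (forall k, [/\ a <= s k, s k <= t k & t k <= b]) ->
      trivIset setT (fun k => `]s k, t k[%classic) ->
      \sum_(k < n) (t k - s k) < d ->
      \sum_(k < n) `|f (t k) - f (s k)| < e.

(** A function whose increments are controlled by those of two absolutely
continuous functions and of the identity is absolutely continuous; all the
closure properties below are instances. *)
Lemma abs_cont_lipschitz_comb f g h (K : R) : abs_cont f -> abs_cont g -> 0 <= K ->
  (forall x y, x \in `[a, b] -> y \in `[a, b] ->
     `|h x - h y| <= K * (`|f x - f y| + `|g x - g y| + `|x - y|)) ->
  abs_cont h.
Proof.
move=> hf hg K0 H e e0.
pose c := e / (3 * (K + 1)).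
have K1 : 0 < K + 1 by rewrite ltr_wpDl.
have c0 : 0 < c by rewrite divr_gt0// mulr_gt0.
have [d1 d10 h1] := hf _ c0.
have [d2 d20 h2] := hg _ c0.
exists (Num.min c (Num.min d1 d2)); first by rewrite !lt_min c0 d10 d20.
move=> n s t st tr.
rewrite !lt_min => /andP[sc /andP[sd1 sd2]].
have H1 := h1 _ _ _ st tr sd1.
have H2 := h2 _ _ _ st tr sd2.
apply: (@le_lt_trans _ _ (\sum_(k < n) (K * (`|f (t k) - f (s k)| +
    `|g (t k) - g (s k)| + (t k - s k))))).
  apply: ler_sum => k _; have [ask stk tkb] := st k.
  have := H (t k) (s k).
  rewrite (ger0_norm (x := t k - s k)) ?subr_ge0//; apply.
    by rewrite in_itv/= tkb (le_trans ask).
  by rewrite in_itv/= ask (le_trans stk).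
rewrite -mulr_sumr big_split/= big_split/=.
apply: (@le_lt_trans _ _ (K * (c + c + c))).
  by rewrite ler_wpM2l// ltW// !ltrD.
rewrite /c.
apply: (@lt_le_trans _ _ ((K + 1) * (3 * (e / (3 * (K + 1)))))).
  have -> : K * (c + c + c) = K * (3 * c) by ring.
  by rewrite -/c ltr_pM2r ?ltrDl// mulr_gt0.
rewrite le_eqVlt; apply/orP; left; apply/eqP; field.
by rewrite gt_eqF.
Qed.

Lemma abs_cont_id : abs_cont id.
Proof.
move=> e e0; exists e => // n s t st _; apply: le_lt_trans.
by apply: ler_sum => k _; have [_ stk _] := st k; rewrite ger0_norm// subr_ge0.
Qed.

Lemma abs_cont_lipschitz h (K : R) :
  (forall x y, x \in `[a, b] -> y \in `[a, b] -> `|h x - h y| <= K * `|x - y|) ->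
  abs_cont h.
Proof.
move=> H; apply: (abs_cont_lipschitz_comb abs_cont_id abs_cont_id (normr_ge0 K)).
move=> x y xab yab; apply: le_trans (H _ _ xab yab) _.
apply: le_trans (ler_wpM2r _ (ler_norm K)) _ => //.
by rewrite ler_wpM2l// lerDr addr_ge0.
Qed.

Lemma abs_contD f g : abs_cont f -> abs_cont g -> abs_cont (fun x => f x + g x).
Proof.
move=> hf hg; apply: (abs_cont_lipschitz_comb hf hg ler01) => x y _ _.
rewrite mul1r opprD addrACA ler_wpDr//; exact: ler_normD.
Qed.

Lemma abs_contZ c f : abs_cont f -> abs_cont (fun x => c * f x).
Proof.
move=> hf; apply: (abs_cont_lipschitz_comb hf hf (normr_ge0 c)) => x y _ _.
by rewrite -mulrBr normrM ler_wpM2l// -addrA ler_wpDr ?addr_ge0.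
Qed.

Lemma abs_contN f : abs_cont f -> abs_cont (fun x => - f x).
Proof.
move=> hf; apply: (abs_cont_lipschitz_comb hf hf ler01) => x y _ _.
by rewrite -opprD normrN mul1r -addrA ler_wpDr ?addr_ge0.
Qed.

Lemma abs_contB f g : abs_cont f -> abs_cont g -> abs_cont (fun x => f x - g x).
Proof. by move=> hf hg; apply: abs_contD => //; exact: abs_contN. Qed.

Lemma abs_cont_within_continuous f : abs_cont f -> {within `[a, b], continuous f}.
Proof.
move=> hf; apply/subspace_continuousP => x xab; apply/cvgrPdist_le => e e0.
have [d d0 hd] := hf _ e0.
rewrite near_withinE; near=> t => tab.
have xt : `|t - x| < d.
  by near: t; apply/nbhs_ballP; exists d => //= t; rewrite /ball/= distrC.
have xab' : a <= x <= b by move: xab; rewrite /= in_itv.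
have tab' : a <= t <= b by move: tab; rewrite /= in_itv.
move: xab' tab' => /andP[ax xb] /andP[at_ tb].
apply/ltW.
have tI s t' : trivIset setT (fun k : 'I_1 => `]s k, t' k[%classic : set R).
  by move=> i j _ _ _; rewrite (ord1 i) (ord1 j).
case: (leP x t) => xlt.
- have := hd 1%N (fun=> x) (fun=> t).
  rewrite !big_ord1 distrC; apply=> //.
  by move: xt; rewrite ger0_norm// subr_ge0.
- have := hd 1%N (fun=> t) (fun=> x).
  rewrite !big_ord1; apply=> //; first by move=> _; rewrite (ltW xlt).
  by move: xt; rewrite distrC ger0_norm// subr_ge0 ltW.
Unshelve. all: by end_near. Qed.

Lemma abs_cont_bounded f : abs_cont f -> a <= b ->
  exists2 K : R, 0 <= K & forall x, x \in `[a, b] -> `|f x| <= K.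
Proof.
move=> /abs_cont_within_continuous cf ab.
have cN : {within `[a, b], continuous (fun x => `|f x|)}.
  move=> x; apply: cvg_norm; exact: cf.
have [c cab hc] := EVT_max ab cN.
by exists `|f c| => // x xab; exact: hc.
Qed.

Lemma abs_contM f g : a <= b -> abs_cont f -> abs_cont g ->
  abs_cont (fun x => f x * g x).
Proof.
move=> ab hf hg.
have [K K0 hK] := abs_cont_bounded hf ab.
have [K' K'0 hK'] := abs_cont_bounded hg ab.
apply: (abs_cont_lipschitz_comb hf hg (addr_ge0 K0 K'0)) => x y xab yab.
have -> : f x * g x - f y * g y = f x * (g x - g y) + (f x - f y) * g y by ring.
apply: le_trans (ler_normD _ _) _; rewrite !normrM.
have h1 : `|f x| * `|g x - g y| <= K * `|g x - g y| by rewrite ler_wpM2r// hK.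
have h2 : `|f x - f y| * `|g y| <= K' * `|f x - f y|.
  by rewrite mulrC ler_wpM2r// hK'.
apply: le_trans (lerD h1 h2) _.
have := mulr_ge0 K0 (normr_ge0 (f x - f y)).
have := mulr_ge0 K'0 (normr_ge0 (g x - g y)).
have := mulr_ge0 K0 (normr_ge0 (x - y)).
have := mulr_ge0 K'0 (normr_ge0 (x - y)).
lra.
Qed.

End AbsolutelyContinuous.

Lemma ae_imp (R : realType) (P Q : R -> Prop) : (forall x, P x -> Q x) ->
  {ae @lebesgue_measure R, forall x, P x} -> {ae @lebesgue_measure R, forall x, Q x}.
Proof.
by move=> PQ; apply: filterS => //; exact: (ae_filter_ringOfSetsType lebesgue_measure).
Qed.

Lemma ae_imp2 (R : realType) (P P' Q : R -> Prop) : (forall x, P x -> P' x -> Q x) ->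
  {ae @lebesgue_measure R, forall x, P x} -> {ae @lebesgue_measure R, forall x, P' x} ->
  {ae @lebesgue_measure R, forall x, Q x}.
Proof.
by move=> PQ; apply: filterS2 => //; exact: (ae_filter_ringOfSetsType lebesgue_measure).
Qed.

(** The total length of a disjoint family, as in the definition of absolute
continuity, is the measure of its union. *)
Lemma lebesgue_measure_disjoint_itvs (R : realType) (n : nat) (s t : 'I_n -> R) :
  (forall k, s k <= t k) -> trivIset setT (fun k => `]s k, t k[%classic) ->
  (@lebesgue_measure R (\big[setU/set0]_(k < n) `]s k, t k[%classic) =
   (\sum_(k < n) (t k - s k))%:E)%E.
Proof.
move=> st tr; rewrite measure_semi_additive_ord//=; last first.
  by apply: bigsetU_measurable => k _; exact: measurable_itv.
rewrite -sumEFin; apply: eq_bigr => k _.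
rewrite lebesgue_measure_itv/= lte_fin lt_neqAle st andbT.
by case: eqVneq => //= ->; rewrite subrr.
Qed.

Section ZeroDerivative.
Variables (R : realType) (a : R).
Notation mu := (@lebesgue_measure R).

(** f x - f a is at most e (x - a), up to the increments of f over finitely many
disjoint subintervals of [a, x] contained in V. Here V will be an open set of
small measure that contains the points where the derivative is not 0 or does not
exist. *)
Definition itv_chain (f : R -> R) (V : set R) (e x : R) : Prop :=
  exists (n : nat) (s t : nat -> R),
    [/\ forall k, (k < n)%N -> [/\ a <= s k, s k <= t k & t k <= x],
        forall k, (k < n)%N -> `]s k, t k[%classic `<=` V,
        trivIset `I_n (fun k => `]s k, t k[%classic) &
        `|f x - f a| <= e * (x - a) + \sum_(k < n) `|f (t k) - f (s k)|].

Lemma itv_chain_step f V e x y : 0 < e -> a <= x -> x <= y ->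
  `|f y - f x| <= e * (y - x) \/ `]x, y[%classic `<=` V ->
  itv_chain f V e x -> itv_chain f V e y.
Proof.
move=> e0 ax xy h [n [s [t [h1 h2 h3 h4]]]].
have tri : `|f y - f a| <= `|f y - f x| + `|f x - f a|.
  by rewrite -(subrKA (f x)); exact: ler_normD.
case: h => h.
- exists n, s, t; split => //.
    by move=> k kn; have [? ? h5] := h1 k kn; split => //; exact: le_trans xy.
  apply: le_trans tri _; apply: le_trans (lerD h h4) _.
  by rewrite addrA -mulrDr; apply: lerD => //; rewrite addrA subrK.
- exists n.+1, (fun k => if (k < n)%N then s k else x),
    (fun k => if (k < n)%N then t k else y); split.
  + move=> k kn; case: ifPn => [kn'|_]; last by split.
    by have [? ? h5] := h1 k kn'; split => //; exact: le_trans xy.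
  + by move=> k kn; case: ifPn => [kn'|_] //; exact: h2.
  + have disj k z : (k < n)%N -> s k < z < t k -> x < z < y -> False.
      move=> kn /andP[_ zt] /andP[xz _].
      have [_ _ tx] := h1 _ kn.
      by move: (lt_trans (lt_le_trans zt tx) xz); rewrite ltxx.
    move=> i j/=; rewrite /mkset !ltnS => ni nj [z []] /=; rewrite !in_itv/=.
    case: ifPn => ni'; case: ifPn => nj' zi zj.
    * by apply: (h3 i j) => //; exists z; split; rewrite /= in_itv.
    * by have := disj i z ni' zi zj.
    * by have := disj j z nj' zj zi.
    * by apply/eqP; rewrite eqn_leq; move: ni' nj'; rewrite -!leqNgt => ni' nj';
        rewrite (leq_trans ni nj') (leq_trans nj ni').
  + rewrite big_ord_recr/= ltnn.
    under eq_bigr do rewrite ltn_ord.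
    apply: le_trans tri _; rewrite [leRHS]addrA [leLHS]addrC lerD2r.
    apply: le_trans h4 _; rewrite lerD2r ler_wpM2l ?(ltW e0)//.
    by rewrite lerD2r.
Qed.

(** An absolutely continuous function whose derivative is zero almost everywhere
takes equal values at the endpoints. Every point of [a, b] has a neighbourhood on
which a chain can be prolonged, either by smallness of the difference quotient or
inside V; so the supremum of the points reached by a chain is b, and absolute
continuity bounds the increments inside V. *)
Lemma abs_cont_ae_rderiv0_end f b : a <= b -> abs_cont a b f ->
  {ae mu, forall x, x \in `[a, b] -> rderiv a b f x 0} -> f b = f a.
Proof.
move=> ab hf [N [mN N0 hN]].
apply/eqP; rewrite -subr_eq0 -normr_le0; apply/ler_addgt0Pr => e0 e0pos; rewrite add0r.
pose e := e0 / (b - a + 1).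
have ba1 : 0 < b - a + 1 by rewrite ltr_wpDl// subr_ge0.
have epos : 0 < e by rewrite divr_gt0.
have [d dpos hd] := hf _ epos.
have [V [oV NV muVN]] : exists V : set R,
    [/\ open V, N `<=` V & (mu (V `\` N) < d%:E)%E].
  apply: lebesgue_regularity_outer mN _ dpos.
  by rewrite [X in (X < _)%E](_ : _ = 0%E) ?ltry//; exact: N0.
have mV : measurable V by exact: measurable_realfun.open_measurable.
have muV : (mu V < d%:E)%E.
  apply: le_lt_trans muVN.
  rewrite -[X in mu X](setDKU NV).
  have mVN : measurable (V `\` N) by exact: measurableD.
  have := @measureU2 _ _ _ mu _ _ mVN mN.
  by move/le_trans; apply; rewrite [X in (_ + X)%E](_ : _ = 0%E) ?adde0.
pose S := [set x | x \in `[a, b] /\ itv_chain f V e x].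
have Sa : S a.
  split; first by rewrite in_itv/= lexx.
  exists 0%N, (fun=> a), (fun=> a); split => //.
  by rewrite big_ord0 !subrr normr0 mulr0 addr0.
have hS : has_sup S.
  split; first by exists a.
  by exists b => x [] /=; rewrite in_itv/= => /andP[].
pose c := sup S.
have ac : a <= c by apply: ub_le_sup => //; case: hS.
have cb : c <= b.
  by apply: sup_le_ub; [exists a|move=> x [] /=; rewrite in_itv/= => /andP[]].
have cab : c \in `[a, b] by rewrite in_itv/= ac.
(* near c, one of the two alternatives of [itv_chain_step] always applies *)
have [r r0 hr] : exists2 r, 0 < r & forall x y, x \in `[a, b] -> y \in `[a, b] ->
    x <= y -> (x = c /\ y < c + r \/ y = c /\ c - r < x) ->
    `|f y - f x| <= e * (y - x) \/ `]x, y[%classic `<=` V.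
  have [cN|cN] := pselect (N c).
    have /nbhs_ballP[r /= r0 rV] : nbhs c V by apply: open_nbhs_nbhs; split => //; exact: NV.
    exists r => // x y xab yab xy hxy; right => z /=; rewrite in_itv/= => /andP[xz zy].
    apply: rV; rewrite /ball/= ltr_norml.
    by case: hxy => -[h1 h2]; subst; lra.
  have /rderivP/(_ _ epos) : rderiv a b f c 0.
    have [//|nh] := pselect (rderiv a b f c 0); exfalso; apply: cN; apply: hN => /=.
    by move=> /(_ cab).
  move=> /nbhs_ballP[r /= r0 rV].
  exists r => // x y xab yab xy hxy; left.
  case: hxy => -[h1 h2]; subst.
  - have := rV y; rewrite /ball/= mul0r subr0 (ger0_norm (x := y - c)) ?subr_ge0//.
    by apply => //; rewrite distrC ger0_norm ?subr_ge0//; lra.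
  - have := rV x; rewrite /ball/= mul0r subr0 distrC => K.
    rewrite (_ : sup S - x = `|x - c|); last by rewrite ler0_norm ?subr_le0// opprB.
    by rewrite (distrC (f _)); apply: K => //; rewrite ler0_norm ?subr_le0//; lra.
have Sc : S c.
  have [x [xab xS] xc] := sup_adherent r0 hS.
  have xlec : x <= c by apply: ub_le_sup; [case: hS|split].
  split => //; apply: itv_chain_step xS => //.
    by move: xab; rewrite in_itv/= => /andP[].
  by apply: hr => //; right; split.
have cEb : c = b.
  apply/eqP; rewrite eq_le cb/=.
  pose y := Num.min b (c + r / 2).
  have cy : c <= y by rewrite /y le_min cb/= lerDl divr_ge0// ltW.
  have yab : y \in `[a, b] by rewrite in_itv/= (le_trans ac cy)/= ge_min lexx.
  have Sy : S y.
    split => //; apply: itv_chain_step (proj2 Sc) => //.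
    apply: hr => //; left; split => //.
    by rewrite gt_min; apply/orP; right; rewrite ltrD2l ltr_pdivrMr// ltr_pMr// ltr1n.
  have : y <= c by apply: ub_le_sup => //; case: hS.
  rewrite /y ge_min => /orP[//|].
  by rewrite gerDl; lra.
have [_ [n [s [t [h1 h2 h3 h4]]]]] := Sc.
rewrite cEb in h1 h4.
apply: le_trans h4 _.
have st (k : 'I_n) : [/\ a <= s k, s k <= t k & t k <= b] by exact: h1.
have tr : trivIset setT (fun k : 'I_n => `]s k, t k[%classic : set R).
  by move=> i j _ _ h; apply: ord_inj; apply: (h3 i j) => //=.
have sum_lt : \sum_(k < n) (t k - s k) < d.
  rewrite -lte_fin -lebesgue_measure_disjoint_itvs//; last first.
    by move=> k; have [] := st k.
  apply: le_lt_trans muV; apply: le_measure; rewrite ?inE//.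
    by apply: bigsetU_measurable => k _; exact: measurable_itv.
  apply: (big_ind (fun A : set R => A `<=` V)) => [|A B AV BV|k _].
  - exact: sub0set.
  - by rewrite subUset.
  - exact: h2.
have := hd n _ _ st tr sum_lt => /ltW h5.
apply: le_trans (lerD (lexx _) h5) _.
rewrite -{2}(mulr1 e) -mulrDr /e mulrAC -mulrA divff ?gt_eqF// mulr1//.
Qed.

Lemma abs_cont_sub f b c : c <= b -> abs_cont a b f -> abs_cont a c f.
Proof.
move=> cb hf e /hf[d d0 h]; exists d => // n s t st; apply: h => k.
by have [? ? h] := st k; split => //; exact: le_trans cb.
Qed.

(** Hence such a function is constant on the segment. *)
Lemma abs_cont_ae_rderiv0 f b : abs_cont a b f ->
  {ae mu, forall x, x \in `[a, b] -> rderiv a b f x 0} ->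
  forall x, x \in `[a, b] -> f x = f a.
Proof.
move=> hf h x; rewrite in_itv/= => /andP[ax xb].
apply: abs_cont_ae_rderiv0_end => //; first exact: abs_cont_sub hf.
move: h; apply: ae_imp => y hy yax.
have yab : y \in `[a, b].
  by move: yax; rewrite !in_itv/= => /andP[-> /=] /le_trans; apply.
apply/rderivP => e e0; have /rderivP/(_ _ e0) := hy yab.
apply: filterS => t ht tax; apply: ht.
by move: tax; rewrite !in_itv/= => /andP[-> /=] /le_trans; apply.
Qed.

End ZeroDerivative.

(** * Indefinite integrals *)

Section IndefiniteIntegral.
Variables (R : realType) (a b : R).
Notation mu := (@lebesgue_measure R).
Implicit Types h : R -> R.

Lemma eq_rderiv (f g : R -> R) x l : x \in `[a, b] ->
  (forall t, t \in `[a, b] -> f t = g t) -> rderiv a b f x l -> rderiv a b g x l.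
Proof.
move=> xab fg /rderivP h; apply/rderivP => e e0; apply: filterS (h _ e0) => t ht tab.
by rewrite -!fg//; exact: ht.
Qed.

Lemma integrable_normr (A : set R) h : measurable A ->
  mu.-integrable A (EFin \o h) -> mu.-integrable A (EFin \o (fun x => `|h x|)).
Proof.
move=> mA hi; have := integrable_abse hi.
by apply: eq_integrable.
Qed.

Lemma integrable_fctD (A : set R) (f g : R -> R) : measurable A ->
  mu.-integrable A (EFin \o f) -> mu.-integrable A (EFin \o g) ->
  mu.-integrable A (EFin \o (fun x => f x + g x)).
Proof. by move=> mA hf hg; exact: (@integrableD _ _ _ mu A mA _ _ hf hg). Qed.

Lemma integrable_fctB (A : set R) (f g : R -> R) : measurable A ->
  mu.-integrable A (EFin \o f) -> mu.-integrable A (EFin \o g) ->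
  mu.-integrable A (EFin \o (fun x => f x - g x)).
Proof. by move=> mA hf hg; exact: (@integrableB _ _ _ mu A mA _ _ hf hg). Qed.

Lemma integrable_fctZ (A : set R) (c : R) (f : R -> R) : measurable A ->
  mu.-integrable A (EFin \o f) -> mu.-integrable A (EFin \o (fun x => c * f x)).
Proof. by move=> mA hf; exact: (@integrableZl _ _ _ mu A mA c _ hf). Qed.

Lemma Rintegral_disjoint_itvs n (s t : 'I_n -> R) h :
  trivIset setT (fun k => `]s k, t k[%classic) ->
  (forall x, 0 <= h x) -> mu.-integrable setT (EFin \o h) ->
  \int[mu]_(x in \big[setU/set0]_(k < n) `]s k, t k[%classic) h x =
  \sum_(k < n) \int[mu]_(x in `]s k, t k[) h x.
Proof.
move=> tr h0 hi; rewrite /Rintegral ge0_integral_bigsetU//=.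
- rewrite sum_fine// => k _.
  apply: integrable_fin_num => //.
  by apply: integrableS hi.
- exact: index_enum_uniq.
- by apply: sub_trivIset tr.
- have mh := @measurable_int _ _ _ mu _ _ hi; exact: (measurable_funS measurableT (@subsetT _ _) mh).
- by move=> x _; rewrite lee_fin.
Qed.

Lemma primitiveB h s t : mu.-integrable `[a, b] (EFin \o h) ->
  a <= s -> s <= t -> t <= b ->
  \int[mu]_(x in `[a, t]) h x - \int[mu]_(x in `[a, s]) h x =
  \int[mu]_(x in `]s, t]) h x.
Proof.
move=> hi as_ st tb; rewrite Rintegral_itvB//.
by apply: integrableS hi => //; apply: subset_itvl; rewrite bnd_simp.
Qed.

Lemma abs_cont_primitive h : mu.-integrable `[a, b] (EFin \o h) ->
  abs_cont a b (fun x => \int[mu]_(t in `[a, x]) h t).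
Proof.
move=> hi e e0.
pose g x := `|(h \_ `[a, b]) x|.
have gi0 : mu.-integrable setT (EFin \o (h \_ `[a, b])).
  by rewrite -restrict_EFin; apply/integrable_restrict => //=; rewrite setTI.
have gi : mu.-integrable setT (EFin \o g) by exact: integrable_normr.
have [d [d0 hd]] := integral_normr_continuous gi0 e0.
exists d => // n s t st tr sd.
have mA : measurable (\big[setU/set0]_(k < n) `]s k, t k[%classic : set R).
  by apply: bigsetU_measurable => k _; exact: measurable_itv.
have muA := hd _ mA.
apply: le_lt_trans (muA _); last first.
  rewrite [X in (X < _)%E](lebesgue_measure_disjoint_itvs _ tr) ?lte_fin//.
  by move=> k; have [] := st k.
rewrite (Rintegral_disjoint_itvs tr)//.
apply: ler_sum => k _; have [ask stk tkb] := st k.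
rewrite primitiveB//.
have hik : mu.-integrable `]s k, t k] (EFin \o h).
  apply: integrableS hi => // x /=; rewrite !in_itv/= => /andP[sx xt].
  by rewrite (le_trans ask (ltW sx)) (le_trans xt).
apply: le_trans (le_normr_Rintegral _ hik) _ => //.
rewrite Rintegral_itv_bndo_bndc; last exact: integrableS gi.
rewrite le_eqVlt; apply/orP; left; apply/eqP; apply: eq_Rintegral => x.
rewrite inE/= in_itv/= => /andP[sx xt].
by rewrite patchE mem_set//= in_itv/= (le_trans ask (ltW sx)) (le_trans xt).
Qed.

Lemma ae_neq (c : R) : {ae mu, forall x, x != c}.
Proof.
exists [set c]; split => //; first by rewrite [LHS]lebesgue_measure_set1.
by move=> x /= /negP; rewrite negbK => /eqP.
Qed.

(** Lebesgue's differentiation theorem for the primitive, in relative form: the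
integrand is extended by zero outside [a, b], and the left endpoint is discarded
as a null set. *)
Lemma rderiv_primitive h : mu.-integrable `[a, b] (EFin \o h) ->
  {ae mu, forall x, x \in `[a, b] ->
    rderiv a b (fun x => \int[mu]_(t in `[a, x]) h t) x (h x)}.
Proof.
move=> hi.
have gi : mu.-integrable setT (EFin \o (h \_ `[a, b])).
  by rewrite -restrict_EFin; apply/integrable_restrict => //=; rewrite setTI.
have li : locally_integrable setT (h \_ `[a, b]) by exact: integrable_locally.
have := @FTC1 R (h \_ `[a, b]) (BLeft a).
move=> /(_ _ li) H.
have igi y : mu.-integrable `[a, y] (EFin \o (h \_ `[a, b])).
  by apply: integrableS gi.
move: (H igi) (ae_neq a); apply: ae_imp2 => x hx xa xab.
have ax : a < x.
  by move: xab; rewrite in_itv/= => /andP[ax _]; rewrite lt_neqAle ax eq_sym xa.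
have [] := hx.
  by rewrite lte_fin.
rewrite derive1E patchE mem_set//= => dF Fx.
have : is_derive x 1 (fun x => \int[mu]_(t in `[a, x]) (h \_ `[a, b]) t) (h x).
  by apply: DeriveDef.
move/(is_derive_rderiv a b); apply: eq_rderiv => // t tab.
apply: eq_Rintegral => y; rewrite inE/= in_itv/= => /andP[ay yt].
rewrite patchE mem_set//= in_itv/= ay/= (le_trans yt)//.
by move: tab; rewrite in_itv/= => /andP[].
Qed.

End IndefiniteIntegral.

(** * Square integrable functions on [0, len] *)

Section SquareIntegrable.
Variables (R : realType) (len : R).
Hypothesis len_gt0 : 0 < len.
Notation mu := (@lebesgue_measure R).
Notation I := (`[0, len]%classic : set R).
Notation normc := ComplexField.Normc.normc.
Implicit Types (h : R -> R) (f g : R -> R[i]) (z : R[i]).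

Lemma sqr_normc z : normc z ^+ 2 = complex.Re z ^+ 2 + complex.Im z ^+ 2.
Proof. by case: z => u v /=; rewrite sqr_sqrtr// addr_ge0 ?sqr_ge0. Qed.

Lemma mu_itv0 : mu I = len%:E.
Proof. by rewrite lebesgue_measure_itv/= lte_fin len_gt0 EFinN sube0. Qed.

Lemma Rintegral_cst_itv0 (c : R) : \int[mu]_(x in I) c = c * len.
Proof. by rewrite Rintegral_cst//= mu_itv0. Qed.

Lemma continuous_integrable h : {within I, continuous h} -> mu.-integrable I (EFin \o h).
Proof. by apply: continuous_compact_integrable; exact: segment_compact. Qed.

Lemma integrable_cst_itv0 (c : R) : mu.-integrable I (EFin \o (fun=> c)).
Proof. by apply: continuous_integrable => x; exact: cvg_cst. Qed.

Lemma integrable_of_sqr h : measurable_fun I h ->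
  mu.-integrable I (EFin \o (fun x => h x ^+ 2)) -> mu.-integrable I (EFin \o h).
Proof.
move=> mh h2.
have h1 : mu.-integrable I (EFin \o (fun x => 1 + h x ^+ 2)).
  by apply: integrable_fctD => //; exact: integrable_cst_itv0.
apply: le_integrable h1 => //; first exact/measurable_EFinP.
move=> x _; rewrite /= lee_fin (ger0_norm (x := 1 + _)) ?addr_ge0 ?sqr_ge0//.
rewrite -(real_normK (num_real (h x))); have := sqr_ge0 (`|h x| - 1); nra.
Qed.

(** The Cauchy-Schwarz inequality against the constant function 1. *)
Lemma Rintegral_normr_le h : measurable_fun I h ->
  mu.-integrable I (EFin \o (fun x => h x ^+ 2)) ->
  \int[mu]_(x in I) `|h x| <= Num.sqrt (len * \int[mu]_(x in I) (h x ^+ 2)).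
Proof.
move=> mh h2; have h1 := integrable_normr (measurable_itv `[0, len]) (integrable_of_sqr mh h2).
set J := \int[mu]_(x in I) `|h x|; set K := \int[mu]_(x in I) (h x ^+ 2).
have J0 : 0 <= J by apply: Rintegral_ge0.
rewrite -(ger0_norm J0) -sqrtr_sqr; apply: ler_wsqrtr.
(* integrate 2 c |h| - c^2 <= h^2 with c the mean value of |h| *)
pose c := J / len.
have hc : mu.-integrable I (EFin \o (fun x => 2 * c * `|h x|)).
  exact: integrable_fctZ.
have h3 : mu.-integrable I (EFin \o (fun x => 2 * c * `|h x| - c ^+ 2)).
  by apply: integrable_fctB => //; exact: integrable_cst_itv0.
have : \int[mu]_(x in I) (2 * c * `|h x| - c ^+ 2) <= K.
  apply: le_Rintegral => // x _.
  by rewrite -(real_normK (num_real (h x))); have := sqr_ge0 (`|h x| - c); nra.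
rewrite RintegralB//; last exact: integrable_cst_itv0.
rewrite Rintegral_cst_itv0 RintegralZl//.
rewrite -/J => h4.
have -> : J ^+ 2 = len * (2 * c * J - c ^+ 2 * len).
  by rewrite /c; field; rewrite gt_eqF.
by rewrite ler_wpM2l// ltW.
Qed.

Lemma integrable_sqr_normc f : inL2 len f ->
  mu.-integrable I (EFin \o (fun x => normc (f x) ^+ 2)).
Proof.
move=> [mr mi fin]; apply/integrableP; split.
  apply/measurable_EFinP.
rewrite [X in measurable_fun _ X](_ : _ = fun x => complex.Re (f x) ^+ 2 + complex.Im (f x) ^+ 2).
  by apply: measurable_funD; apply: measurable_funX.
  by apply/funext => x; rewrite sqr_normc.
under eq_integral => x _ do rewrite /= ger0_norm ?sqr_ge0//.
exact: fin.
Qed.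

Lemma inL2_Re_sqr f : inL2 len f ->
  mu.-integrable I (EFin \o (fun x => complex.Re (f x) ^+ 2)).
Proof.
move=> fL2; have [mr mi fin] := fL2.
apply: le_integrable (integrable_sqr_normc fL2) => //.
  by apply/measurable_EFinP; apply: measurable_funX.
move=> x _; rewrite /= lee_fin !ger0_norm ?sqr_ge0// sqr_normc.
by rewrite lerDl sqr_ge0.
Qed.

Lemma inL2_Im_sqr f : inL2 len f ->
  mu.-integrable I (EFin \o (fun x => complex.Im (f x) ^+ 2)).
Proof.
move=> fL2; have [mr mi fin] := fL2.
apply: le_integrable (integrable_sqr_normc fL2) => //.
  by apply/measurable_EFinP; apply: measurable_funX.
move=> x _; rewrite /= lee_fin !ger0_norm ?sqr_ge0// sqr_normc.
by rewrite lerDr sqr_ge0.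
Qed.

Lemma inL2_Re_integrable f : inL2 len f -> mu.-integrable I (EFin \o (fun x => complex.Re (f x))).
Proof. by move=> h; apply: integrable_of_sqr (inL2_Re_sqr h); case: h. Qed.

Lemma inL2_Im_integrable f : inL2 len f -> mu.-integrable I (EFin \o (fun x => complex.Im (f x))).
Proof. by move=> h; apply: integrable_of_sqr (inL2_Im_sqr h); case: h. Qed.

Lemma Rintegral_Re_le f : inL2 len f ->
  \int[mu]_(x in I) `|complex.Re (f x)| <= Num.sqrt len * L2norm len f.
Proof.
move=> h; apply: le_trans (Rintegral_normr_le _ (inL2_Re_sqr h)) _; first by case: h.
rewrite /L2norm -sqrtrM ?(ltW len_gt0)//; apply: ler_wsqrtr.
rewrite ler_wpM2l ?(ltW len_gt0)//; apply: le_Rintegral => //.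
- exact: inL2_Re_sqr.
- exact: integrable_sqr_normc.
- by move=> x _; rewrite sqr_normc lerDl sqr_ge0.
Qed.

Lemma Rintegral_Im_le f : inL2 len f ->
  \int[mu]_(x in I) `|complex.Im (f x)| <= Num.sqrt len * L2norm len f.
Proof.
move=> h; apply: le_trans (Rintegral_normr_le _ (inL2_Im_sqr h)) _; first by case: h.
rewrite /L2norm -sqrtrM ?(ltW len_gt0)//; apply: ler_wsqrtr.
rewrite ler_wpM2l ?(ltW len_gt0)//; apply: le_Rintegral => //.
- exact: inL2_Im_sqr.
- exact: integrable_sqr_normc.
- by move=> x _; rewrite sqr_normc lerDr sqr_ge0.
Qed.

Lemma continuous_inL2 f : {within I, continuous (fun x => complex.Re (f x))} ->
  {within I, continuous (fun x => complex.Im (f x))} -> inL2 len f.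
Proof.
move=> cr ci; split.
- by apply: subspace_continuous_measurable_fun.
- by apply: subspace_continuous_measurable_fun.
- have : mu.-integrable I (EFin \o (fun x => complex.Re (f x) * complex.Re (f x)
      + complex.Im (f x) * complex.Im (f x))).
    apply: continuous_integrable => x.
    by apply: cvgD; apply: cvgM; [exact: cr|exact: cr|exact: ci|exact: ci].
  move=> /integrableP[_]; apply: le_lt_trans.
  rewrite le_eqVlt; apply/orP; left; apply/eqP; apply: eq_integral => x _.
  by rewrite /= sqr_normc !expr2 ger0_norm// addr_ge0 ?sqr_ge0 -?expr2.
Qed.

Lemma L2norm_le_sup f (B : R) : 0 <= B ->
  {within I, continuous (fun x => complex.Re (f x))} ->
  {within I, continuous (fun x => complex.Im (f x))} ->
  (forall x, I x -> `|complex.Re (f x)| <= B /\ `|complex.Im (f x)| <= B) ->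
  L2norm len f <= Num.sqrt (2 * len) * B.
Proof.
move=> B0 cr ci hB.
have fL2 := continuous_inL2 cr ci.
rewrite /L2norm -(ger0_norm B0) -sqrtr_sqr -sqrtrM ?mulr_ge0 ?(ltW len_gt0)//.
apply: ler_wsqrtr.
rewrite (_ : 2 * len * B ^+ 2 = \int[mu]_(x in I) (2 * B ^+ 2)); last first.
  by rewrite Rintegral_cst_itv0; ring.
apply: le_Rintegral => //; first exact: integrable_sqr_normc.
  exact: integrable_cst_itv0.
move=> x xI; have [h1 h2] := hB x xI.
rewrite sqr_normc -(real_normK (num_real (complex.Re _))).
rewrite -(real_normK (num_real (complex.Im _))).
have := normr_ge0 (complex.Re (f x)); have := normr_ge0 (complex.Im (f x)); nra.
Qed.

Lemma inL2_lincomb (z : R[i]) f g : inL2 len f -> inL2 len g ->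
  inL2 len (fun x => z * f x + g x).
Proof.
move=> fL gL; have [mfr mfi _] := fL; have [mgr mgi _] := gL.
have ReE x : complex.Re (z * f x + g x) =
    complex.Re z * complex.Re (f x) - complex.Im z * complex.Im (f x) + complex.Re (g x).
  by case: (z) (f x) (g x) => z1 z2 [f1 f2] [g1 g2].
have ImE x : complex.Im (z * f x + g x) =
    complex.Re z * complex.Im (f x) + complex.Im z * complex.Re (f x) + complex.Im (g x).
  by case: (z) (f x) (g x) => z1 z2 [f1 f2] [g1 g2].
have mr : measurable_fun I (fun x => complex.Re (z * f x + g x)).
  rewrite (funext ReE).
  by apply: measurable_funD => //; apply: measurable_funB; apply: measurable_funM.
have mi : measurable_fun I (fun x => complex.Im (z * f x + g x)).
  rewrite (funext ImE).
  by apply: measurable_funD => //; apply: measurable_funD; apply: measurable_funM.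
split => //.
pose c := 3 * (complex.Re z ^+ 2 + complex.Im z ^+ 2) + 3.
have hi : mu.-integrable I (EFin \o
    (fun x => c * (normc (f x) ^+ 2) + c * (normc (g x) ^+ 2))).
  by apply: integrable_fctD => //; apply: integrable_fctZ => //;
    exact: integrable_sqr_normc.
have /integrableP[_] : mu.-integrable I (EFin \o (fun x => normc (z * f x + g x) ^+ 2)).
  apply: le_integrable hi => //.
    apply/measurable_EFinP.
    rewrite [X in measurable_fun _ X](funext (fun x => sqr_normc _)).
    by apply: measurable_funD; apply: measurable_funX.
  move=> x _; rewrite /= lee_fin [leLHS]ger0_norm ?sqr_ge0//.
  apply: le_trans (ler_norm _).
  rewrite !sqr_normc ReE ImE /c.
  move: (complex.Re z) (complex.Im z) (complex.Re (f x)) (complex.Im (f x))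
    (complex.Re (g x)) (complex.Im (g x)) => z1 z2 f1 f2 g1 g2.
  have := sqr_ge0 (z1 * f1 - (- (z2 * f2))); have := sqr_ge0 (z1 * f1 - g1).
  have := sqr_ge0 (z2 * f2 + g1); have := sqr_ge0 (z1 * f2 - z2 * f1).
  have := sqr_ge0 (z1 * f2 - g2); have := sqr_ge0 (z2 * f1 - g2).
  have h0 : 0 <= (z1 ^+ 2 + z2 ^+ 2) * (g1 ^+ 2 + g2 ^+ 2).
    by rewrite mulr_ge0 ?addr_ge0 ?sqr_ge0.
  have := sqr_ge0 f1; have := sqr_ge0 f2; have := sqr_ge0 g1; have := sqr_ge0 g2.
  rewrite !expr2 in h0 *; lra.
by under eq_integral => x _ do rewrite /= ger0_norm ?sqr_ge0//.
Qed.

End SquareIntegrable.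

(** * Complex-valued absolutely continuous functions *)

Section ComplexAbsCont.
Variables (R : realType) (a b : R).
Notation normc := ComplexField.Normc.normc.
Implicit Types (z : R[i]).

Lemma ReD (z z' : R[i]) : complex.Re (z + z') = complex.Re z + complex.Re z'.
Proof. by case: z z' => ? ? []. Qed.

Lemma ImD (z z' : R[i]) : complex.Im (z + z') = complex.Im z + complex.Im z'.
Proof. by case: z z' => ? ? []. Qed.

Lemma ReB (z z' : R[i]) : complex.Re (z - z') = complex.Re z - complex.Re z'.
Proof. by case: z z' => ? ? []. Qed.

Lemma ImB (z z' : R[i]) : complex.Im (z - z') = complex.Im z - complex.Im z'.
Proof. by case: z z' => ? ? []. Qed.

Lemma ReM (z z' : R[i]) : complex.Re (z * z') =
  complex.Re z * complex.Re z' - complex.Im z * complex.Im z'.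
Proof. by case: z z' => ? ? []. Qed.

Lemma ImM (z z' : R[i]) : complex.Im (z * z') =
  complex.Re z * complex.Im z' + complex.Im z * complex.Re z'.
Proof. by case: z z' => ? ? []. Qed.

Lemma normRe_le z : `|complex.Re z| <= normc z.
Proof.
case: z => x y /=; rewrite -sqrtr_sqr; apply: ler_wsqrtr.
by rewrite lerDl sqr_ge0.
Qed.

Lemma normIm_le z : `|complex.Im z| <= normc z.
Proof.
case: z => x y /=; rewrite -sqrtr_sqr; apply: ler_wsqrtr.
by rewrite lerDr sqr_ge0.
Qed.

Lemma normc_le z : normc z <= `|complex.Re z| + `|complex.Im z|.
Proof.
case: z => x y /=.
rewrite -[leRHS]ger0_norm ?addr_ge0// -sqrtr_sqr; apply: ler_wsqrtr.
rewrite sqrrD !real_normK ?num_real// lerD2r lerDl.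
by rewrite mulrn_wge0// mulr_ge0.
Qed.

Lemma abs_continuousP (f : R -> R[i]) : abs_continuous a b f <->
  abs_cont a b (fun x => complex.Re (f x)) /\ abs_cont a b (fun x => complex.Im (f x)).
Proof.
split=> [h|[h1 h2] e e0].
- split=> e /h[d d0 hd]; exists d => // n s t st tr sd;
    apply: le_lt_trans (hd _ _ _ st tr sd); apply: ler_sum => k _.
  + by rewrite -ReB normRe_le.
  + by rewrite -ImB normIm_le.
- have e2 : 0 < e / 2 by rewrite divr_gt0.
  have [d1 d10 hd1] := h1 _ e2; have [d2 d20 hd2] := h2 _ e2.
  exists (Num.min d1 d2); first by rewrite lt_min d10.
  move=> n s t st tr; rewrite lt_min => /andP[sd1 sd2].
  rewrite (splitr e).
  apply: le_lt_trans (ltrD (hd1 _ _ _ st tr sd1) (hd2 _ _ _ st tr sd2)).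
  rewrite -big_split/=; apply: ler_sum => k _.
  by rewrite -ReB -ImB normc_le.
Qed.

End ComplexAbsCont.

(** * Uniform continuity in a parameter *)

Section ParameterContinuity.
Variables (R : realType) (l : R).
Implicit Types (T : Type).

(** f m t tends to f l t as m tends to l, uniformly for t in D, and f l is
bounded on D. The bound makes the notion stable under products. *)
Definition unif_cont_at T (D : set T) (f : R -> T -> R) : Prop :=
  (exists K : R, forall t, D t -> `|f l t| <= K) /\
  forall e : R, 0 < e -> \forall m \near l, forall t, D t -> `|f m t - f l t| <= e.

Lemma unif_cont_at_cst T (D : set T) (g : T -> R) (K : R) :
  (forall t, D t -> `|g t| <= K) -> unif_cont_at D (fun=> g).
Proof.
move=> gK; split; first by exists K.
move=> e e0; near=> m => t _; by rewrite subrr normr0 ltW.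
Unshelve. all: by end_near. Qed.

Lemma unif_cont_atD T (D : set T) f g : unif_cont_at D f -> unif_cont_at D g ->
  unif_cont_at D (fun m t => f m t + g m t).
Proof.
move=> [[K hK] hf] [[K' hK'] hg]; split.
  exists (K + K') => t Dt; apply: le_trans (ler_normD _ _) _.
  by rewrite lerD ?hK ?hK'.
move=> e e0; have e2 : 0 < e / 2 by rewrite divr_gt0.
move: (hf _ e2) (hg _ e2); apply: filterS2 => m h1 h2 t Dt.
rewrite opprD addrACA (splitr e); apply: le_trans (ler_normD _ _) _.
by rewrite lerD ?h1 ?h2.
Qed.

Lemma unif_cont_atN T (D : set T) f : unif_cont_at D f ->
  unif_cont_at D (fun m t => - f m t).
Proof.
move=> [[K hK] hf]; split; first by exists K => t Dt; rewrite normrN hK.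
move=> e e0; apply: filterS (hf _ e0) => m h t Dt.
by rewrite -opprD normrN h.
Qed.

Lemma unif_cont_atB T (D : set T) f g : unif_cont_at D f -> unif_cont_at D g ->
  unif_cont_at D (fun m t => f m t - g m t).
Proof. by move=> hf hg; apply: unif_cont_atD => //; exact: unif_cont_atN. Qed.

Lemma unif_cont_atM T (D : set T) f g : unif_cont_at D f -> unif_cont_at D g ->
  unif_cont_at D (fun m t => f m t * g m t).
Proof.
move=> [[K hK] hf] [[K' hK'] hg]; split.
  exists (K * K') => t Dt; rewrite normrM; apply: ler_pM => //; [exact: hK|exact: hK'].
move=> e e0.
pose C := `|K| + `|K'| + 2.
have C0 : 0 < C by rewrite /C ltr_wpDl// addr_ge0.
(* the bound 1 absorbs one factor of the quadratic term *)
have e2 : 0 < Num.min 1 (e / C) by rewrite lt_min ltr01 divr_gt0.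
move: (hf _ e2) (hg _ e2); apply: filterS2 => m h1 h2 t Dt.
have {}h1 := h1 t Dt; have {}h2 := h2 t Dt.
rewrite !le_min in h1 h2; move/andP: h1 => [_ h1]; move/andP: h2 => [h2' h2].
have -> : f m t * g m t - f l t * g l t =
  (f m t - f l t) * (g m t - g l t) + (f m t - f l t) * g l t + f l t * (g m t - g l t).
  by ring.
apply: le_trans (ler_normD _ _) _; apply: le_trans (lerD (ler_normD _ _) (lexx _)) _.
rewrite !normrM.
have eC : e = e / C * C by rewrite divfK// gt_eqF.
rewrite [leRHS]eC; set d := e / C in h1 h2 *.
have d0 : 0 <= d by rewrite ltW// divr_gt0.
have k1 : `|f m t - f l t| * `|g m t - g l t| <= d * 1 by apply: ler_pM.
have k2 : `|f m t - f l t| * `|g l t| <= d * `|K'|.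
  by apply: ler_pM => //; apply: le_trans (hK' _ Dt) (ler_norm _).
have k3 : `|f l t| * `|g m t - g l t| <= `|K| * d.
  by apply: ler_pM => //; apply: le_trans (hK _ Dt) (ler_norm _).
rewrite /C; lra.
Qed.

Lemma unif_cont_at_cvg (D : set R) (f : R -> R -> R) (t : R) : D t ->
  unif_cont_at D f -> f m t @[m --> l] --> f l t.
Proof.
move=> Dt [_ h]; apply/cvgrPdist_le => e e0; apply: filterS (h _ e0) => m hm.
by rewrite distrC; exact: hm.
Qed.

Lemma unif_cont_at_Rintegral T (D : set T) (len : R) (f : R -> T -> R -> R) : 0 < len ->
  (forall m t, D t -> (@lebesgue_measure R).-integrable `[0, len] (EFin \o f m t)) ->
  unif_cont_at [set p | D p.1 /\ p.2 \in `[0, len]] (fun m p => f m p.1 p.2) ->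
  unif_cont_at D (fun m t => \int[lebesgue_measure]_(y in `[0, len]) f m t y).
Proof.
move=> len0 fi [[K hK] hf].
have bound (g : R -> R) (C : R) :
    (@lebesgue_measure R).-integrable `[0, len] (EFin \o g) ->
    (forall y, y \in `[0, len] -> `|g y| <= C) ->
    `|\int[lebesgue_measure]_(y in `[0, len]) g y| <= C * len.
  move=> gi gC; apply: le_trans (le_normr_Rintegral _ gi) _ => //.
  rewrite -(Rintegral_cst_itv0 len0); apply: le_Rintegral => //.
  - exact: integrable_normr.
  - exact: integrable_cst_itv0.
split.
  exists (K * len) => t Dt; apply: bound; first exact: fi.
  by move=> y yI; apply: (hK (t, y)).
move=> e e0; have e2 : 0 < e / len by rewrite divr_gt0.
apply: filterS (hf _ e2) => m hm t Dt.
rewrite -RintegralB//; [|exact: fi|exact: fi].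
rewrite -[leRHS](divfK (lt0r_neq0 len0)); apply: bound.
  by apply: integrable_fctB => //; exact: fi.
by move=> y yI; apply: (hm (t, y)).
Qed.

Lemma is_derive_mul_sub (g : R -> R) : g m @[m --> l] --> g l ->
  is_derive l 1 (fun m => (m - l) * g m) (g l).
Proof.
move=> cg.
suff K : (h^-1 *: ((fun m => (m - l) * g m) (h *: 1 + l) - (l - l) * g l))
    @[h --> 0^'] --> g l.
  by split; [apply/cvg_ex; exists (g l)|apply/cvg_lim].
apply/cvgrPdist_le => e e0.
have /cvgrPdist_le/(_ _ e0) /nbhs_ballP[d /= d0 H] := cg.
rewrite /dnbhs near_withinE; apply/nbhs_ballP; exists d => //= h.
rewrite /ball/= sub0r normrN => hd h0.
rewrite /(_ *: _)/= mulr1 addrK subrr mul0r subr0 mulKf//.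
by apply: H; rewrite /ball/= opprD addrCA subrr addr0 normrN.
Qed.

End ParameterContinuity.

(** * The fundamental matrix *)

Lemma sum_ord2 (V : nmodType) (F : 'I_2 -> V) : \sum_(i < 2) F i = F 0 + F 1.
Proof.
rewrite big_ord_recl big_ord1; congr (_ + F _).
exact: ord_inj.
Qed.

Lemma ord2P (i : 'I_2) : i = 0 \/ i = 1.
Proof. by case: i => -[|[|]]// ilt; [left|right]; exact: ord_inj. Qed.

Lemma invmx2 (R : comUnitRingType) (A : 'M[R]_2) :
  A 0 0 * A 1 1 - A 0 1 * A 1 0 = 1 ->
  [/\ invmx A 0 0 = A 1 1, invmx A 0 1 = - A 0 1,
      invmx A 1 0 = - A 1 0 & invmx A 1 1 = A 0 0].
Proof.
move=> detA.
pose B : 'M[R]_2 := \matrix_(i, j) if i == j then A (1 - i) (1 - j) else - A i j.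
have AB : A *m B = 1%:M.
  apply/matrixP => i j; rewrite !mxE sum_ord2 !mxE.
  by case: (ord2P i) => ->; case: (ord2P j) => ->; rewrite /= ?subr0 ?subrr -?detA; ring.
have uA : A \in unitmx by have [] := mulmx1_unit AB.
have -> : invmx A = B by rewrite -[LHS]mulmx1 -AB mulKmx.
by rewrite !mxE /= ?subr0 ?subrr.
Qed.

Section EvansFunction.
Variables (R : realType) (len eps : R) (A0 : R -> 'M[R]_2) (U : R -> R -> 'M[R]_2).
Hypothesis len_gt0 : 0 < len.
Hypothesis A0_cont : forall i j, {within `[0, len], continuous (fun x => A0 x i j)}.
Hypothesis A0_trace : forall x : R, x \in `[0, len] -> \tr (A0 x) = 0.
Hypothesis U_fundamental : fundamental_matrix len eps A0 U.
Implicit Types (l x : R) (j : 'I_2).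

Let zero_in : (0 : R) \in `[0, len]. Proof. by rewrite in_itv/= lexx ltW. Qed.

Let len_in : len \in `[0, len]. Proof. by rewrite in_itv/= lexx ltW. Qed.

Lemma trace0_entry x : x \in `[0, len] -> A0 x 1 1 = - A0 x 0 0.
Proof.
by move=> xI; have := A0_trace xI; rewrite /mxtrace sum_ord2 => /addr0_eq ->.
Qed.

(** The two rows of the matrix equation U' = A(x, l) U. *)
Lemma U_rderiv_row0 l x j : x \in `[0, len] ->
  rderiv 0 len (fun t => U t l 0 j) x (A0 x 0 0 * U x l 0 j + A0 x 0 1 * U x l 1 j).
Proof.
move=> xI; have [_ /(_ x xI)/has_deriv_in_mxP/(_ 0 j)] := U_fundamental l.
rewrite /system_matrix !mxE sum_ord2 !mxE !big_ord1 !mxE/=.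
by rewrite !mul0r mulr0 !addr0.
Qed.
Arguments U_rderiv_row0 l [x] j _.

Lemma U_rderiv_row1 l x j : x \in `[0, len] ->
  rderiv 0 len (fun t => U t l 1 j) x
    ((A0 x 1 0 + eps * l) * U x l 0 j - A0 x 0 0 * U x l 1 j).
Proof.
move=> xI; have [_ /(_ x xI)/has_deriv_in_mxP/(_ 1 j)] := U_fundamental l.
rewrite /system_matrix !mxE sum_ord2 !mxE !big_ord1 !mxE/= (trace0_entry xI).
by rewrite !mul1r mulr1 mulr0 addr0 mulNr.
Qed.
Arguments U_rderiv_row1 l [x] j _.

Lemma U_init l : [/\ U 0 l 0 0 = 1, U 0 l 0 1 = 0, U 0 l 1 0 = 0 & U 0 l 1 1 = 1].
Proof. by have [-> _] := U_fundamental l; rewrite !mxE. Qed.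

(** Liouville's formula: the trace of A(x, l) is that of A0, which is zero. *)
Lemma U_det l x : x \in `[0, len] ->
  U x l 0 0 * U x l 1 1 - U x l 0 1 * U x l 1 0 = 1.
Proof.
move=> xI.
transitivity (U 0 l 0 0 * U 0 l 1 1 - U 0 l 0 1 * U 0 l 1 0); last first.
  by have [-> -> -> ->] := U_init l; rewrite mulr1 mulr0 subr0.
apply: (@rderiv0_cst R 0 len
  (fun t => U t l 0 0 * U t l 1 1 - U t l 0 1 * U t l 1 0)) => // t tI.
have := rderivB (rderivM (U_rderiv_row0 l 0 tI) (U_rderiv_row1 l 1 tI))
  (rderivM (U_rderiv_row0 l 1 tI) (U_rderiv_row1 l 0 tI)).
by congr rderiv; ring.
Qed.

Lemma U_continuous l i j : {within `[0, len], continuous (fun t => U t l i j)}.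
Proof.
case: (ord2P i) => ->.
- by apply: rderiv_continuous => x; exact: U_rderiv_row0.
- by apply: rderiv_continuous => x; exact: U_rderiv_row1.
Qed.
Arguments U_continuous l i j : clear implicits.

Lemma within_continuous_bounded (f : R -> R) : {within `[0, len], continuous f} ->
  exists2 K : R, 0 <= K & forall x, x \in `[0, len] -> `|f x| <= K.
Proof.
move=> cf.
have cN : {within `[0, len], continuous (fun x => `|f x|)}.
  move=> x; apply: cvg_norm; exact: cf.
have [c cab hc] := EVT_max (ltW len_gt0) cN.
by exists `|f c| => // x xab; exact: hc.
Qed.

Lemma U_bounded l : exists2 K : R, 0 <= K &
  forall x i j, x \in `[0, len] -> `|U x l i j| <= K.
Proof.
have [K00 a0 h00] := within_continuous_bounded (U_continuous l 0 0).
have [K01 a1 h01] := within_continuous_bounded (U_continuous l 0 1).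
have [K10 a2 h10] := within_continuous_bounded (U_continuous l 1 0).
have [K11 a3 h11] := within_continuous_bounded (U_continuous l 1 1).
exists (K00 + K01 + (K10 + K11)); first by rewrite !addr_ge0.
move=> x i j xI; have := h00 x xI; have := h01 x xI; have := h10 x xI.
have := h11 x xI.
by case: (ord2P i) => ->; case: (ord2P j) => ->; lra.
Qed.

Lemma U_abs_cont l i j : abs_cont 0 len (fun t => U t l i j).
Proof.
have [f' hf' cf'] : exists2 f' : R -> R,
    (forall x, x \in `[0, len] -> rderiv 0 len (fun t => U t l i j) x (f' x)) &
    {within `[0, len], continuous f'}.
  case: (ord2P i) => ->.
  - exists (fun x => A0 x 0 0 * U x l 0 j + A0 x 0 1 * U x l 1 j).
      by move=> x; exact: U_rderiv_row0.
    move=> x; apply: cvgD; apply: cvgM; first [exact: A0_cont|exact: U_continuous].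
  - exists (fun x => (A0 x 1 0 + eps * l) * U x l 0 j - A0 x 0 0 * U x l 1 j).
      by move=> x; exact: U_rderiv_row1.
    move=> x; apply: cvgB; apply: cvgM; try exact: A0_cont; try exact: U_continuous.
    by apply: cvgD; [exact: A0_cont|exact: cvg_cst].
have [K K0 hK] := within_continuous_bounded cf'.
by apply: (@abs_cont_lipschitz _ _ _ _ K); exact: rderiv_lipschitz hf' hK.
Qed.

Notation mu := (@lebesgue_measure R).
Notation I := (`[0, len]%classic : set R).

Variables (BL BR : 'rV[R]_2) (NL : 'cV[R]_2).
Hypothesis NL_span :
  forall v : 'cV[R]_2, BL *m v = 0 <-> exists c : R, v = c *: NL.
Hypothesis eps_pm1 : eps = 1 \/ eps = -1.

(** * Solving the boundary value problem when E is not zero *)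

(** The row B_R M. *)
Let brow l j := (BR *m monodromy len U l) 0 j.

Lemma browE l j : brow l j = BR 0 0 * U len l 0 j + BR 0 1 * U len l 1 j.
Proof. by rewrite /brow mxE sum_ord2. Qed.

Lemma EvansE l : Evans len BR NL U l = brow l 0 * NL 0 0 + brow l 1 * NL 1 0.
Proof. by rewrite /Evans mxE sum_ord2. Qed.

Lemma BL_NL : BL 0 0 * NL 0 0 + BL 0 1 * NL 1 0 = 0.
Proof.
have : BL *m NL = 0 by apply/NL_span; exists 1; rewrite scale1r.
by move/matrixP/(_ 0 0); rewrite !mxE sum_ord2.
Qed.

(** The second column of U^-1, that is U^-1 e2. *)
Let coef l k y := if k == 0 :> 'I_2 then - U y l 0 1 else U y l 0 0.

(** The k-th entry of int_0^x U^-1 e2 h. *)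
Let prim l (h : R -> R) k x := \int[mu]_(y in `[0, x]) (coef l k y * h y).

(** The scalar B_R M q(len) / E, where q = int_0^x U^-1 e2 h; subtracting its
product with N_L from q keeps the left boundary condition and imposes the right
one. *)
Let shift l h := (brow l 0 * prim l h 0 len + brow l 1 * prim l h 1 len) /
  Evans len BR NL U l.

(** The i-th entry of the solution of u' = A u + eps h e2 with both boundary
conditions. *)
Let sol l h i x := eps * (U x l i 0 * (prim l h 0 x - NL 0 0 * shift l h) +
  U x l i 1 * (prim l h 1 x - NL 1 0 * shift l h)).

Lemma coef_continuous l k : {within I, continuous (coef l k)}.
Proof.
rewrite /coef; case: (ord2P k) => -> /=; last exact: U_continuous.
by move=> x; apply: cvgN; exact: U_continuous.
Qed.

Lemma coef_bounded l : exists2 K : R, 0 <= K &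
  forall x k, x \in `[0, len] -> `|coef l k x| <= K.
Proof.
have [K K0 hK] := U_bounded l; exists K => // x k xI.
by rewrite /coef; case: ifP => _; rewrite ?normrN hK.
Qed.

Lemma continuous_mul_integrable (c h : R -> R) : {within I, continuous c} ->
  mu.-integrable I (EFin \o h) -> mu.-integrable I (EFin \o (fun y => c y * h y)).
Proof.
move=> cc hi; have [K K0 hK] := within_continuous_bounded cc.
have mh : measurable_fun I h by case/integrableP: (hi) => /measurable_EFinP.
have mc : measurable_fun I c by exact: subspace_continuous_measurable_fun.
have hi' : mu.-integrable I (EFin \o (fun y => K * h y)) by exact: integrable_fctZ.
apply: le_integrable hi' => //.
  by apply/measurable_EFinP; exact: measurable_funM.
move=> x xI; rewrite /= lee_fin !normrM (ger0_norm K0) ler_wpM2r//.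
by apply: hK; rewrite inE in xI *.
Qed.

Lemma coef_integrable l h k : mu.-integrable I (EFin \o h) ->
  mu.-integrable I (EFin \o (fun y => coef l k y * h y)).
Proof. by apply: continuous_mul_integrable; exact: coef_continuous. Qed.

Lemma prim0 l h k : prim l h k 0 = 0.
Proof. by rewrite /prim set_itv1 Rintegral_set1. Qed.

Lemma sol_abs_cont l h i : mu.-integrable I (EFin \o h) ->
  abs_cont 0 len (sol l h i).
Proof.
move=> hi.
have hp k c : abs_cont 0 len (fun x => prim l h k x - c).
  apply: abs_contB; first by apply: abs_cont_primitive; exact: coef_integrable.
  by apply: (@abs_cont_lipschitz _ _ _ _ 0) => x y _ _; rewrite subrr normr0 mul0r.
apply: abs_contZ; apply: abs_contD; apply: abs_contM => //; rewrite ?ltW//;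
  exact: U_abs_cont.
Qed.

Lemma sol_rderiv l h : mu.-integrable I (EFin \o h) ->
  {ae mu, forall x, x \in `[0, len] ->
    rderiv 0 len (sol l h 0) x (A0 x 0 0 * sol l h 0 x + A0 x 0 1 * sol l h 1 x) /\
    rderiv 0 len (sol l h 1) x
      ((A0 x 1 0 + eps * l) * sol l h 0 x - A0 x 0 0 * sol l h 1 x + eps * h x)}.
Proof.
move=> hi.
have h0 := rderiv_primitive (coef_integrable l 0 hi).
have h1 := rderiv_primitive (coef_integrable l 1 hi).
move: h0 h1; apply: ae_imp2 => x h0 h1 xI.
have {}h0 := h0 xI; have {}h1 := h1 xI.
have dp k c v : rderiv 0 len (prim l h k) x v ->
    rderiv 0 len (fun x => prim l h k x - c) x v.
  by move=> hv; have := rderivB hv (rderiv_cst _ _ c x); rewrite subr0.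
have {}h0 := dp _ (NL 0 0 * shift l h) _ h0.
have {}h1 := dp _ (NL 1 0 * shift l h) _ h1.
have detU := U_det l xI.
split.
- have := rderivZ (c := eps) (rderivD (rderivM (U_rderiv_row0 l 0 xI) h0)
    (rderivM (U_rderiv_row0 l 1 xI) h1)).
  by congr rderiv; rewrite /sol /coef /=; ring.
- have := rderivZ (c := eps) (rderivD (rderivM (U_rderiv_row1 l 0 xI) h0)
    (rderivM (U_rderiv_row1 l 1 xI) h1)).
  congr rderiv; rewrite /sol /coef /=.
  rewrite -[h x in RHS]mul1r -detU; ring.
Qed.

Lemma sol_left l h : BL 0 0 * sol l h 0 0 + BL 0 1 * sol l h 1 0 = 0.
Proof.
rewrite /sol !prim0; have [-> -> -> ->] := U_init l.
have := BL_NL; move: (shift l h) => c hB.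
rewrite [LHS](_ : _ = - eps * c * (BL 0 0 * NL 0 0 + BL 0 1 * NL 1 0)); last by ring.
by rewrite hB mulr0.
Qed.

Lemma sol_right l h : Evans len BR NL U l != 0 ->
  BR 0 0 * sol l h 0 len + BR 0 1 * sol l h 1 len = 0.
Proof.
move=> E0; rewrite /sol.
transitivity (eps * (brow l 0 * prim l h 0 len + brow l 1 * prim l h 1 len
   - (brow l 0 * NL 0 0 + brow l 1 * NL 1 0) * shift l h)).
  by rewrite !browE; ring.
by rewrite -EvansE /shift mulrCA divff// mulr1 subrr mulr0.
Qed.

Lemma ae_eq_Rintegral (h h' : R -> R) (A : set R) : measurable A ->
  mu.-integrable A (EFin \o h) -> mu.-integrable A (EFin \o h') ->
  {ae mu, forall x, A x -> h x = h' x} ->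
  \int[mu]_(x in A) h x = \int[mu]_(x in A) h' x.
Proof.
move=> mA hi hi' hh; congr fine; apply: ae_eq_integral => //.
- by case/integrableP: hi.
- by case/integrableP: hi'.
- by move: hh; apply: ae_imp => x hx Ax; rewrite hx.
Qed.

Lemma sub_I x : x \in `[0, len] -> `[0, x]%classic `<=` I.
Proof.
rewrite in_itv/= => /andP[_ xl] y /=; rewrite !in_itv/= => /andP[-> /=] yx.
exact: le_trans xl.
Qed.

Lemma coef_integrable_sub l h k x : x \in `[0, len] ->
  mu.-integrable I (EFin \o h) ->
  mu.-integrable `[0, x]%classic (EFin \o (fun y => coef l k y * h y)).
Proof.
by move=> xI /coef_integrable hi; apply: integrableS (hi l k) => //; exact: sub_I.
Qed.

Lemma prim_ae_eq l h h' k x : x \in `[0, len] ->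
  mu.-integrable I (EFin \o h) -> mu.-integrable I (EFin \o h') ->
  {ae mu, forall x, x \in `[0, len] -> h x = h' x} -> prim l h k x = prim l h' k x.
Proof.
move=> xI hi hi' hh; apply: ae_eq_Rintegral => //; try exact: coef_integrable_sub.
by move: hh; apply: ae_imp => y hy /(sub_I xI) yI; rewrite hy.
Qed.

Lemma sol_ae_eq l h h' i x : x \in `[0, len] ->
  mu.-integrable I (EFin \o h) -> mu.-integrable I (EFin \o h') ->
  {ae mu, forall x, x \in `[0, len] -> h x = h' x} -> sol l h i x = sol l h' i x.
Proof.
move=> xI hi hi' hh; rewrite /sol /shift !(prim_ae_eq _ _ _ hi hi' hh)//.
Qed.

Lemma prim_lin l (c d : R) h h' h'' k x : x \in `[0, len] ->
  mu.-integrable I (EFin \o h) -> mu.-integrable I (EFin \o h') ->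
  mu.-integrable I (EFin \o h'') ->
  prim l (fun y => c * h y + d * h' y + h'' y) k x =
  c * prim l h k x + d * prim l h' k x + prim l h'' k x.
Proof.
move=> xI hi hi' hi''; rewrite /prim.
have i1 := coef_integrable_sub l k xI hi.
have i2 := coef_integrable_sub l k xI hi'.
have i3 := coef_integrable_sub l k xI hi''.
rewrite -!RintegralZl// -!RintegralD//.
- by apply: eq_Rintegral => y _; ring.
- by apply: integrable_fctD => //; exact: integrable_fctZ.
- exact: integrable_fctZ.
- exact: integrable_fctZ.
Qed.

(** Two coefficients are needed because the real part of z f mixes the real and
imaginary parts of f. *)
Lemma sol_lin l (c d : R) h h' h'' i x : x \in `[0, len] ->
  mu.-integrable I (EFin \o h) -> mu.-integrable I (EFin \o h') ->
  mu.-integrable I (EFin \o h'') ->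
  sol l (fun y => c * h y + d * h' y + h'' y) i x =
  c * sol l h i x + d * sol l h' i x + sol l h'' i x.
Proof.
by move=> xI hi hi' hi''; rewrite /sol /shift !prim_lin//; ring.
Qed.

Lemma sol_bounded l : exists2 C : R, 0 <= C &
  forall h i x, x \in `[0, len] -> mu.-integrable I (EFin \o h) ->
  `|sol l h i x| <= C * \int[mu]_(y in I) `|h y|.
Proof.
have [K K0 hK] := U_bounded l; have [K' K'0 hK'] := coef_bounded l.
have hprim h k x : x \in `[0, len] -> mu.-integrable I (EFin \o h) ->
    `|prim l h k x| <= K' * \int[mu]_(y in I) `|h y|.
  move=> xI hi; have ci := coef_integrable_sub l k xI hi.
  apply: le_trans (le_normr_Rintegral _ ci) _ => //.
  have nhi : mu.-integrable I (EFin \o (fun y => `|h y|)) by exact: integrable_normr.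
  rewrite -RintegralZl//.
  have i2 : mu.-integrable I (EFin \o (fun y => K' * `|h y|)) by exact: integrable_fctZ.
  apply: (@le_trans _ _ (\int[mu]_(y in `[0, x]) (K' * `|h y|))).
    apply: le_Rintegral => //.
    + exact: integrable_normr.
    + by apply: integrableS i2 => //; exact: sub_I.
    + by move=> y /(sub_I xI) yI; rewrite normrM ler_wpM2r// hK'.
  rewrite /Rintegral fine_le//.
  - by apply: integrable_fin_num => //; apply: integrableS i2 => //; exact: sub_I.
  - exact: integrable_fin_num.
  - apply: ge0_subset_integral => //; last exact: sub_I.
    + by case/integrableP: i2.
    + by move=> y _; rewrite lee_fin mulr_ge0.
pose D := (`|brow l 0| * K' + `|brow l 1| * K') * `|(Evans len BR NL U l)^-1|.
have D0 : 0 <= D by rewrite mulr_ge0// addr_ge0// mulr_ge0.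
pose C := K * (K' + `|NL 0 0| * D) + K * (K' + `|NL 1 0| * D).
exists C.
  by rewrite addr_ge0// mulr_ge0// addr_ge0// mulr_ge0.
move=> h i x xI hi.
set J := \int[mu]_(y in I) `|h y|.
have J0 : 0 <= J by apply: Rintegral_ge0.
have hc : `|shift l h| <= D * J.
  rewrite /shift normrM /D mulrAC ler_wpM2r//.
  apply: le_trans (ler_normD _ _) _; rewrite !normrM mulrDl -!mulrA.
  by apply: lerD; rewrite ler_wpM2l//; exact: hprim.
have part k : `|U x l i k * (prim l h k x - NL k 0 * shift l h)| <=
    K * (K' + `|NL k 0| * D) * J.
  rewrite normrM -mulrA; apply: ler_pM => //; first exact: hK.
  apply: le_trans (ler_normB _ _) _; rewrite mulrDl; apply: lerD; first exact: hprim.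
  by rewrite normrM -mulrA ler_wpM2l.
rewrite /sol normrM (_ : `|eps| = 1) ?mul1r; last first.
  by case: eps_pm1 => ->; rewrite ?normrN normr1.
apply: le_trans (ler_normD _ _) _.
by rewrite /C mulrDl; apply: lerD; exact: part.
Qed.

(** The homogeneous boundary value problem has only the zero solution when E is
not zero: U^-1 (d0, d1) is constant. *)
Lemma hom_sol_unique l (d0 d1 : R -> R) : Evans len BR NL U l != 0 ->
  abs_cont 0 len d0 -> abs_cont 0 len d1 ->
  {ae mu, forall x, x \in `[0, len] ->
    rderiv 0 len d0 x (A0 x 0 0 * d0 x + A0 x 0 1 * d1 x) /\
    rderiv 0 len d1 x ((A0 x 1 0 + eps * l) * d0 x - A0 x 0 0 * d1 x)} ->
  BL 0 0 * d0 0 + BL 0 1 * d1 0 = 0 ->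
  BR 0 0 * d0 len + BR 0 1 * d1 len = 0 ->
  forall x, x \in `[0, len] -> d0 x = 0 /\ d1 x = 0.
Proof.
move=> E0 a0 a1 hd hL hR.
have cU i j := U_abs_cont l i j.
have c0 x : x \in `[0, len] -> U x l 1 1 * d0 x - U x l 0 1 * d1 x = d0 0.
  move=> xI.
  have -> : d0 0 = U 0 l 1 1 * d0 0 - U 0 l 0 1 * d1 0.
    by have [_ -> _ ->] := U_init l; rewrite mul1r mul0r subr0.
  apply: (@abs_cont_ae_rderiv0 R 0 (fun x => U x l 1 1 * d0 x - U x l 0 1 * d1 x)
    len) => //.
    by apply: abs_contB; apply: abs_contM => //; exact: ltW.
  move: hd; apply: ae_imp => y hy yI; have [h0 h1] := hy yI.
  have := rderivB (rderivM (U_rderiv_row1 l 1 yI) h0) (rderivM (U_rderiv_row0 l 1 yI) h1).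
  by congr rderiv; ring.
have c1 x : x \in `[0, len] -> U x l 0 0 * d1 x - U x l 1 0 * d0 x = d1 0.
  move=> xI.
  have -> : d1 0 = U 0 l 0 0 * d1 0 - U 0 l 1 0 * d0 0.
    by have [-> _ -> _] := U_init l; rewrite mul1r mul0r subr0.
  apply: (@abs_cont_ae_rderiv0 R 0 (fun x => U x l 0 0 * d1 x - U x l 1 0 * d0 x)
    len) => //.
    by apply: abs_contB; apply: abs_contM => //; exact: ltW.
  move: hd; apply: ae_imp => y hy yI; have [h0 h1] := hy yI.
  have := rderivB (rderivM (U_rderiv_row0 l 0 yI) h1) (rderivM (U_rderiv_row1 l 0 yI) h0).
  by congr rderiv; ring.
have e0 x : x \in `[0, len] -> d0 x = U x l 0 0 * d0 0 + U x l 0 1 * d1 0.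
  move=> xI; rewrite -[LHS]mul1r -(U_det l xI) -{1}(c0 x xI) -(c1 x xI); ring.
have e1 x : x \in `[0, len] -> d1 x = U x l 1 0 * d0 0 + U x l 1 1 * d1 0.
  move=> xI; rewrite -[LHS]mul1r -(U_det l xI) -{1}(c0 x xI) -(c1 x xI); ring.
pose v : 'cV[R]_2 := \matrix_(i, j) if i == 0 then d0 0 else d1 0.
have [c vE] : exists c, v = c *: NL.
  apply/NL_span; apply/matrixP => i j; rewrite (ord1 i) (ord1 j) !mxE sum_ord2 !mxE/=.
  exact: hL.
have d00 : d0 0 = c * NL 0 0 by have /matrixP/(_ 0 0) := vE; rewrite !mxE.
have d10 : d1 0 = c * NL 1 0 by have /matrixP/(_ 1 0) := vE; rewrite !mxE.
have cE : c * Evans len BR NL U l = 0.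
  by rewrite -[RHS]hR (e0 _ len_in) (e1 _ len_in) d00 d10 EvansE !browE; ring.
have c00 : c = 0 by move/eqP: cE; rewrite mulf_eq0 (negPf E0) orbF => /eqP.
by move=> x xI; rewrite (e0 x xI) (e1 x xI) d00 d10 c00 !mul0r !mulr0 !addr0.
Qed.

(** * The resolvent *)

(** The candidate for the inverse of the operator minus l, acting separately on
real and imaginary parts. *)
Let Tsol l (f : R -> R[i]) : R -> R[i] := fun x =>
  (sol l (fun y => complex.Re (f y)) 0 x +i* sol l (fun y => complex.Im (f y)) 0 x)%C.

Lemma Tsol_continuous l f : inL2 len f ->
  {within I, continuous (fun x => complex.Re (Tsol l f x))} /\
  {within I, continuous (fun x => complex.Im (Tsol l f x))}.
Proof.
move=> fL; split; apply: abs_cont_within_continuous; apply: sol_abs_cont.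
- exact: inL2_Re_integrable.
- exact: inL2_Im_integrable.
Qed.

Lemma Tsol_inL2 l f : inL2 len f -> inL2 len (Tsol l f).
Proof. by move=> /(Tsol_continuous l)[]; exact: continuous_inL2. Qed.

Lemma eqae_Re (f g : R -> R[i]) : eqae len f g ->
  {ae mu, forall x, x \in `[0, len] -> complex.Re (f x) = complex.Re (g x)}.
Proof. by apply: ae_imp => x h /h ->. Qed.

Lemma eqae_Im (f g : R -> R[i]) : eqae len f g ->
  {ae mu, forall x, x \in `[0, len] -> complex.Im (f x) = complex.Im (g x)}.
Proof. by apply: ae_imp => x h /h ->. Qed.

Lemma Tsol_eqae l f g : inL2 len f -> inL2 len g -> eqae len f g ->
  forall x, x \in `[0, len] -> Tsol l f x = Tsol l g x.
Proof.
move=> fL gL fg x xI; rewrite /Tsol; congr (_ +i* _)%C; apply: sol_ae_eq => //.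
- exact: inL2_Re_integrable.
- exact: inL2_Re_integrable.
- exact: eqae_Re.
- exact: inL2_Im_integrable.
- exact: inL2_Im_integrable.
- exact: eqae_Im.
Qed.

Lemma Tsol_lin l (z : R[i]) f g : inL2 len f -> inL2 len g ->
  forall x, x \in `[0, len] ->
    Tsol l (fun y => z * f y + g y) x = z * Tsol l f x + Tsol l g x.
Proof.
move=> fL gL x xI; rewrite /Tsol.
have fr := inL2_Re_integrable fL; have fi := inL2_Im_integrable fL.
have gr := inL2_Re_integrable gL; have gi := inL2_Im_integrable gL.
apply/eqP; rewrite eq_complex ReD ReM ImD ImM /=; apply/andP; split; apply/eqP.
- rewrite -mulNr -sol_lin//; congr (sol l _ 0 x); apply/funext => y.
  by rewrite ReD ReM mulNr.
- rewrite -sol_lin//; congr (sol l _ 0 x); apply/funext => y.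
  by rewrite ImD ImM.
Qed.

Lemma Tsol_bounded l : bounded_operator len (Tsol l).
Proof.
split.
- by move=> f; exact: Tsol_inL2.
- move=> f g fL gL fg; apply: aeW => x xI; exact: Tsol_eqae.
- by move=> z f g fL gL; apply: aeW => x xI; exact: Tsol_lin.
- have [C C0 hC] := sol_bounded l.
  exists (Num.sqrt (2 * len) * (C * Num.sqrt len)) => f fL.
  have [cr ci] := Tsol_continuous l fL.
  rewrite -mulrA; apply: (L2norm_le_sup len_gt0) => //.
    by rewrite !mulr_ge0// ?sqrtr_ge0.
  move=> x xI; split=> /=; rewrite -mulrA.
  + apply: le_trans (hC _ 0 x xI (inL2_Re_integrable fL)) _.
    by rewrite ler_wpM2l// Rintegral_Re_le.
  + apply: le_trans (hC _ 0 x xI (inL2_Im_integrable fL)) _.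
    by rewrite ler_wpM2l// Rintegral_Im_le.
Qed.

Lemma to_cmx_mul0 (B : 'rV[R]_2) (u : 'cV[R[i]]_2) : to_cmx B *m u = 0 <->
  B 0 0 * complex.Re (u 0 0) + B 0 1 * complex.Re (u 1 0) = 0 /\
  B 0 0 * complex.Im (u 0 0) + B 0 1 * complex.Im (u 1 0) = 0.
Proof.
have E : (to_cmx B *m u) 0 0 =
    ((B 0 0 * complex.Re (u 0 0) + B 0 1 * complex.Re (u 1 0)) +i*
     (B 0 0 * complex.Im (u 0 0) + B 0 1 * complex.Im (u 1 0)))%C.
  rewrite mxE sum_ord2 !mxE; apply/eqP; rewrite eq_complex ReD !ReM ImD !ImM /=.
  by rewrite !mul0r !subr0 !addr0 !eqxx.
split.
- by move=> /matrixP/(_ 0 0); rewrite E mxE => -[-> ->].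
- move=> [h1 h2]; apply/matrixP => i j; rewrite (ord1 i) (ord1 j) E h1 h2.
  by rewrite mxE.
Qed.

(** The first order system in terms of real and imaginary parts. *)
Lemma has_cderiv_inP (u : R -> 'cV[R[i]]_2) x (g : R[i]) : x \in `[0, len] ->
  has_cderiv_in `[0, len] u x (to_cmx (A0 x) *m u x + (eps%:C * g) *: delta_mx 1 0) <->
  [/\ rderiv 0 len (fun t => complex.Re (u t 0 0)) x
        (A0 x 0 0 * complex.Re (u x 0 0) + A0 x 0 1 * complex.Re (u x 1 0)),
      rderiv 0 len (fun t => complex.Im (u t 0 0)) x
        (A0 x 0 0 * complex.Im (u x 0 0) + A0 x 0 1 * complex.Im (u x 1 0)),
      rderiv 0 len (fun t => complex.Re (u t 1 0)) x
        (A0 x 1 0 * complex.Re (u x 0 0) - A0 x 0 0 * complex.Re (u x 1 0)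
         + eps * complex.Re g) &
      rderiv 0 len (fun t => complex.Im (u t 1 0)) x
        (A0 x 1 0 * complex.Im (u x 0 0) - A0 x 0 0 * complex.Im (u x 1 0)
         + eps * complex.Im g)].
Proof.
move=> xI; rewrite /has_cderiv_in.
set v := _ + _.
have v0 : v 0 0 = ((A0 x 0 0 * complex.Re (u x 0 0) + A0 x 0 1 * complex.Re (u x 1 0)) +i*
    (A0 x 0 0 * complex.Im (u x 0 0) + A0 x 0 1 * complex.Im (u x 1 0)))%C.
  rewrite /v !mxE sum_ord2 !mxE/= mulr0 addr0.
  apply/eqP; rewrite eq_complex ReD !ReM ImD !ImM /=.
  by rewrite !mul0r !subr0 !addr0 !eqxx.
have v1 : v 1 0 = ((A0 x 1 0 * complex.Re (u x 0 0) - A0 x 0 0 * complex.Re (u x 1 0)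
         + eps * complex.Re g) +i*
    (A0 x 1 0 * complex.Im (u x 0 0) - A0 x 0 0 * complex.Im (u x 1 0)
         + eps * complex.Im g))%C.
  rewrite /v !mxE sum_ord2 !mxE/= mulr1 (trace0_entry xI).
  apply/eqP; rewrite eq_complex !(ReD, ReM, ImD, ImM) /=.
  by rewrite !mul0r !subr0 !addr0 !mulNr !eqxx.
have E (pr : R[i] -> R) i :
  (fun t => map_mx pr (u t) i 0) = (fun t => pr (u t i 0)).
  by apply/funext => t; rewrite mxE.
have Ev (pr : R[i] -> R) (w : 'cV[R[i]]_2) i : (map_mx pr w) i 0 = pr (w i 0).
  by rewrite mxE.
split.
- move=> [/has_deriv_in_mxP hr /has_deriv_in_mxP hi].
  have := hr 0 0; have := hr 1 0; have := hi 0 0; have := hi 1 0.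
  by rewrite !E !Ev v0 v1.
- move=> [h1 h2 h3 h4]; split; apply/has_deriv_in_mxP => i j; rewrite (ord1 j) E Ev;
    by case: (ord2P i) => ->; rewrite ?v0 ?v1.
Qed.

Lemma Tsol_graph l f : Evans len BR NL U l != 0 -> inL2 len f ->
  operator_graph len eps A0 BL BR (Tsol l f) (fun x => f x + l%:C * Tsol l f x).
Proof.
move=> E0 fL; split; first exact: Tsol_inL2.
  have := inL2_lincomb l%:C (Tsol_inL2 l fL) fL.
  by under eq_fun do rewrite addrC.
have fr := inL2_Re_integrable fL; have fi := inL2_Im_integrable fL.
pose s i x := (sol l (fun y => complex.Re (f y)) i x +i*
  sol l (fun y => complex.Im (f y)) i x)%C.
exists (fun x => \col_i s i x); split.
- move=> k; apply/abs_continuousP; split.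
    by under eq_fun do rewrite mxE; exact: sol_abs_cont.
  by under eq_fun do rewrite mxE; exact: sol_abs_cont.
- by apply: aeW => x _; rewrite mxE.
- move: (sol_rderiv l fr) (sol_rderiv l fi); apply: ae_imp2 => x hr hi xI.
  have [hr0 hr1] := hr xI; have [hi0 hi1] := hi xI.
  apply/has_cderiv_inP => //.
  split.
  + by under eq_fun do rewrite mxE; rewrite !mxE.
  + by under eq_fun do rewrite mxE; rewrite !mxE.
  + under eq_fun do rewrite mxE; rewrite !mxE.
    by move: hr1; congr rderiv; rewrite ReD ReM/=; ring.
  + under eq_fun do rewrite mxE; rewrite !mxE.
    by move: hi1; congr rderiv; rewrite ImD ImM/=; ring.
- by apply/to_cmx_mul0; rewrite !mxE/= !sol_left.
- by apply/to_cmx_mul0; rewrite !mxE/= !sol_right.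
Qed.

(** The difference between a witness for (y, g) and the solution constructed from
g - l y solves the homogeneous problem. *)
Lemma Tsol_left_inverse l y g : Evans len BR NL U l != 0 ->
  operator_graph len eps A0 BL BR y g ->
  eqae len (Tsol l (fun x => g x - l%:C * y x)) y.
Proof.
move=> E0 [yL gL [u [uac uy ud uL uR]]].
pose f x := g x - l%:C * y x.
have fE : f = fun x => (- l%:C) * y x + g x.
  by apply/funext => x; rewrite /f mulNr addrC.
have fL : inL2 len f by rewrite fE; exact: inL2_lincomb.
have fr := inL2_Re_integrable fL; have fi := inL2_Im_integrable fL.
have /to_cmx_mul0[uLr uLi] := uL; have /to_cmx_mul0[uRr uRi] := uR.
have /abs_continuousP[a0r a0i] := uac 0; have /abs_continuousP[a1r a1i] := uac 1.
have hr : forall x, x \in `[0, len] ->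
    complex.Re (u x 0 0) - sol l (fun y => complex.Re (f y)) 0 x = 0 /\
    complex.Re (u x 1 0) - sol l (fun y => complex.Re (f y)) 1 x = 0.
  apply: (hom_sol_unique E0 (d0 := fun x => complex.Re (u x 0 0) - _)
    (d1 := fun x => complex.Re (u x 1 0) - _)).
  - by apply: abs_contB => //; exact: sol_abs_cont.
  - by apply: abs_contB => //; exact: sol_abs_cont.
  - have H := sol_rderiv l fr.
    have : {ae mu, forall x, x \in `[0, len] -> u x 0 0 = y x /\ 
        has_cderiv_in `[0, len] u x
          (to_cmx (A0 x) *m u x + (eps%:C * g x) *: delta_mx 1 0)}.
      by move: uy ud; apply: ae_imp2 => x h1 h2 xI; split; [exact: h1|exact: h2].
    move: H; apply: ae_imp2 => x hs hu xI.
    have [s0 s1] := hs xI; have [uxy /(has_cderiv_inP _ _ xI)[u0 _ u1 _]] := hu xI.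
    split.
    + by have := rderivB u0 s0; congr rderiv; ring.
    + have := rderivB u1 s1; congr rderiv.
      by rewrite /f ReB ReM/= -uxy; ring.
  - rewrite !mulrBr addrACA uLr -opprD sol_left subr0//.
  - rewrite !mulrBr addrACA uRr -opprD sol_right// subr0//.
have hi : forall x, x \in `[0, len] ->
    complex.Im (u x 0 0) - sol l (fun y => complex.Im (f y)) 0 x = 0 /\
    complex.Im (u x 1 0) - sol l (fun y => complex.Im (f y)) 1 x = 0.
  apply: (hom_sol_unique E0 (d0 := fun x => complex.Im (u x 0 0) - _)
    (d1 := fun x => complex.Im (u x 1 0) - _)).
  - by apply: abs_contB => //; exact: sol_abs_cont.
  - by apply: abs_contB => //; exact: sol_abs_cont.
  - have H := sol_rderiv l fi.
    have : {ae mu, forall x, x \in `[0, len] -> u x 0 0 = y x /\ 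
        has_cderiv_in `[0, len] u x
          (to_cmx (A0 x) *m u x + (eps%:C * g x) *: delta_mx 1 0)}.
      by move: uy ud; apply: ae_imp2 => x h1 h2 xI; split; [exact: h1|exact: h2].
    move: H; apply: ae_imp2 => x hs hu xI.
    have [s0 s1] := hs xI; have [uxy /(has_cderiv_inP _ _ xI)[_ u0 _ u1]] := hu xI.
    split.
    + by have := rderivB u0 s0; congr rderiv; ring.
    + have := rderivB u1 s1; congr rderiv.
      by rewrite /f ImB ImM/= -uxy; ring.
  - rewrite !mulrBr addrACA uLi -opprD sol_left subr0//.
  - rewrite !mulrBr addrACA uRi -opprD sol_right// subr0//.
move: uy; apply: ae_imp => x uy xI; rewrite -(uy xI) /Tsol -/f.
have [/eqP + _] := hr x xI; have [/eqP + _] := hi x xI.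
rewrite !subr_eq0 => /eqP <- /eqP <-.
by case: (u x 0 0).
Qed.

Lemma spectrum_Evans_eq0 l : operator_spectrum len eps A0 BL BR l%:C ->
  Evans len BR NL U l = 0.
Proof.
move=> h; have [//|E0] := eqVneq (Evans len BR NL U l) 0.
exfalso; apply: h; exists (Tsol l); split.
- exact: Tsol_bounded.
- by move=> f fL; exact: Tsol_graph.
- by move=> y g; exact: Tsol_left_inverse.
Qed.

(** * Dependence on the spectral parameter *)

(** The (k, j) entry of U(t; l)^-1 U(t; m). *)
Let ratio l m k j t := if k == 0 :> 'I_2 then U t l 1 1 * U t m 0 j - U t l 0 1 * U t m 1 j
  else U t l 0 0 * U t m 1 j - U t l 1 0 * U t m 0 j.

Lemma ratio_rderiv l m k j x : x \in `[0, len] ->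
  rderiv 0 len (ratio l m k j) x (eps * (m - l) * (coef l k x * U x m 0 j)).
Proof.
move=> xI; rewrite /ratio /coef; case: (ord2P k) => -> /=.
- have := rderivB (rderivM (U_rderiv_row1 l 1 xI) (U_rderiv_row0 m j xI))
    (rderivM (U_rderiv_row0 l 1 xI) (U_rderiv_row1 m j xI)).
  by congr rderiv; ring.
- have := rderivB (rderivM (U_rderiv_row0 l 0 xI) (U_rderiv_row1 m j xI))
    (rderivM (U_rderiv_row1 l 0 xI) (U_rderiv_row0 m j xI)).
  by congr rderiv; ring.
Qed.

Lemma ratio0 l m k j : ratio l m k j 0 = (k == j)%:R.
Proof.
rewrite /ratio; have [-> -> -> ->] := U_init l; rewrite !mul1r !mul0r !subr0.
have [h1 h2 h3 h4] := U_init m.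
by case: (ord2P k) => ->; case: (ord2P j) => ->; rewrite /= ?h1 ?h2 ?h3 ?h4.
Qed.

Lemma ratioE l m i j x : x \in `[0, len] ->
  U x m i j = U x l i 0 * ratio l m 0 j x + U x l i 1 * ratio l m 1 j x.
Proof.
move=> xI; rewrite -[LHS]mul1r -(U_det l xI) /ratio /=.
by case: (ord2P i) => ->; ring.
Qed.

(** Locally in m, U is Lipschitz in the parameter, uniformly in x. For a column j
let S be the maximum over x of the change in the first row: the equation for
U(t; l)^-1 U(t; m) bounds the change of every entry by kap |m - l| (K + S), which
absorbs S as soon as kap |m - l| <= 1/2. *)
Lemma U_lipschitz_param l : exists C d : R, [/\ 0 <= C, 0 < d &
  forall m x i j, `|m - l| <= d -> x \in `[0, len] ->
    `|U x m i j - U x l i j| <= C * `|m - l|].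
Proof.
have [K K0 hK] := U_bounded l.
pose kap := 2 * K ^+ 2 * len.
have kap0 : 0 <= kap by rewrite !mulr_ge0// ltW.
have kap1 : 0 < 2 * (kap + 1) by rewrite mulr_gt0// ltr_wpDl.
exists (2 * kap * K), (2 * (kap + 1))^-1; split.
- by rewrite mulr_ge0// mulr_ge0.
- by rewrite invr_gt0.
move=> m x i j md xI.
pose D t := U t m 0 j - U t l 0 j.
have cD : {within I, continuous (fun t => `|D t|)}.
  by move=> t; apply: cvg_norm; apply: cvgB; exact: U_continuous.
have [c cI hc] := EVT_max (ltW len_gt0) cD.
set S := `|D c| in hc.
have S0 : 0 <= S by exact: normr_ge0.
have hm t : t \in `[0, len] -> `|U t m 0 j| <= K + S.
  move=> tI; rewrite -(subrK (U t l 0 j) (U t m 0 j)) addrC.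
  by apply: le_trans (ler_normD _ _) _; apply: lerD; [exact: hK|exact: hc].
set a := `|m - l| in md *.
have a0 : 0 <= a by exact: normr_ge0.
have hr k t : t \in `[0, len] -> `|ratio l m k j t - (k == j)%:R| <= a * (K * (K + S)) * len.
  move=> tI; rewrite -(ratio0 l m).
  apply: (@le_trans _ _ (a * (K * (K + S)) * `|t - 0|)).
    apply: (@rderiv_lipschitz R 0 len (ratio l m k j)
      (fun y => eps * (m - l) * (coef l k y * U y m 0 j))) => //.
      by move=> y yI; exact: ratio_rderiv.
    move=> y yI; rewrite !normrM -/a (_ : `|eps| = 1) ?mul1r; last first.
      by case: eps_pm1 => ->; rewrite ?normrN normr1.
    rewrite ler_wpM2l// ler_pM//; last exact: hm.
    by rewrite /coef; case: ifP => _; rewrite ?normrN hK.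
  rewrite subr0 ler_wpM2l ?mulr_ge0 ?addr_ge0//.
  by move: tI; rewrite in_itv/= => /andP[t0 tl]; rewrite ger0_norm.
have hU i' t : t \in `[0, len] -> `|U t m i' j - U t l i' j| <= kap * a * (K + S).
  move=> tI.
  have -> : U t m i' j - U t l i' j = U t l i' 0 * (ratio l m 0 j t - (0 == j)%:R) +
      U t l i' 1 * (ratio l m 1 j t - (1 == j)%:R).
    rewrite (ratioE l m i' j tI); case: (ord2P j) => -> /=; ring.
  apply: le_trans (ler_normD _ _) _; rewrite !normrM.
  have p k : `|U t l i' k| * `|ratio l m k j t - (k == j)%:R| <=
      K * (a * (K * (K + S)) * len).
    by apply: ler_pM => //; [exact: hK|exact: hr].
  apply: le_trans (lerD (p 0) (p 1)) _.
  rewrite le_eqVlt; apply/orP; left; apply/eqP; rewrite /kap; ring.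
have hS : S <= kap * a * (K + S) by exact: hU.
have ka : kap * a <= 1 / 2.
  have h1 : 2 * (kap + 1) * a <= 1.
    by rewrite mulrC -ler_pdivlMr// mul1r.
  lra.
have SK : S <= K.
  have h2 : kap * a * (K + S) <= 1 / 2 * (K + S) by rewrite ler_wpM2r// addr_ge0.
  lra.
apply: le_trans (hU i x xI) _.
have -> : 2 * kap * K * a = kap * a * (K + K) by ring.
by apply: ler_wpM2l; [exact: mulr_ge0|rewrite lerD2l].
Qed.

Lemma U_unif_cont l (T : Type) (D : set T) (p : T -> R) i j :
  (forall t, D t -> p t \in `[0, len]) ->
  unif_cont_at l D (fun m t => U (p t) m i j).
Proof.
move=> hp; split.
  by have [K K0 hK] := U_bounded l; exists K => t /hp pI; exact: hK.
have [C [d [C0 d0 hC]]] := U_lipschitz_param l.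
move=> e e0; apply/nbhs_ballP; exists (Num.min d (e / (C + 1))) => /=.
  by rewrite lt_min d0 divr_gt0// ltr_wpDl.
move=> m; rewrite /ball/= lt_min distrC => /andP[/ltW md /ltW me] t /hp pI.
apply: le_trans (hC m _ i j md pI) _.
apply: (@le_trans _ _ ((C + 1) * `|m - l|)).
  by rewrite ler_wpM2r// lerDl.
by rewrite mulrC -ler_pdivlMr// ltr_wpDl.
Qed.

(** The first entry of U N_L. *)
Let phi m y := U y m 0 0 * NL 0 0 + U y m 0 1 * NL 1 0.

(** The second entry of the row B_R M U^-1(y). *)
Let wrow l y := brow l 0 * coef l 0 y + brow l 1 * coef l 1 y.

Lemma phi_continuous m : {within I, continuous (phi m)}.
Proof.
by move=> x; apply: cvgD; apply: cvgM; try exact: U_continuous; exact: cvg_cst.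
Qed.

Lemma wrow_continuous m : {within I, continuous (wrow m)}.
Proof.
by move=> x; apply: cvgD; apply: cvgM; try exact: coef_continuous; exact: cvg_cst.
Qed.

Lemma Evans_sub l m : Evans len BR NL U m - Evans len BR NL U l =
  (m - l) * (eps * \int[mu]_(y in I) (wrow l y * phi m y)).
Proof.
pose F y := brow l 0 * (ratio l m 0 0 y * NL 0 0 + ratio l m 0 1 y * NL 1 0) +
  brow l 1 * (ratio l m 1 0 y * NL 0 0 + ratio l m 1 1 y * NL 1 0).
have cw : {within I, continuous (fun y => wrow l y * phi m y)}.
  by move=> x; apply: cvgM; [exact: wrow_continuous|exact: phi_continuous].
have FD x : x \in `[0, len] ->
    rderiv 0 len F x ((eps * (m - l)) * (wrow l x * phi m x)).
  move=> xI.
  have r k j := @ratio_rderiv l m k j x xI.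
  have rc k j c := rderivM (r k j) (rderiv_cst 0 len c x).
  have := rderivD (rderivZ (c := brow l 0) (rderivD (rc 0 0 (NL 0 0)) (rc 0 1 (NL 1 0))))
    (rderivZ (c := brow l 1) (rderivD (rc 1 0 (NL 0 0)) (rc 1 1 (NL 1 0)))).
  by congr rderiv; rewrite /wrow /phi; ring.
have cw' : {within I, continuous (fun y => (eps * (m - l)) * (wrow l y * phi m y))}.
  by move=> x; apply: cvgM; [exact: cvg_cst|exact: cw].
have := rderiv_FTC2 len_gt0 FD cw'.
rewrite RintegralZl//; last exact: continuous_integrable.
rewrite mulrA (mulrC (m - l)) => ->; congr (_ - _).
- rewrite EvansE !browE /F !browE /ratio /= -[LHS]mul1r -(U_det l len_in).
  ring.
- by rewrite EvansE /F !ratio0/= !mul1r !mul0r addr0 add0r.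
Qed.

Lemma phi_unif_cont l (T : Type) (D : set T) (p : T -> R) :
  (forall t, D t -> p t \in `[0, len]) ->
  unif_cont_at l D (fun m t => phi m (p t)).
Proof.
move=> hp; apply: unif_cont_atD; apply: unif_cont_atM; try exact: U_unif_cont.
- by apply: (unif_cont_at_cst _ (K := `|NL 0 0|)).
- by apply: (unif_cont_at_cst _ (K := `|NL 1 0|)).
Qed.

Lemma brow_unif_cont l (T : Type) (D : set T) j :
  unif_cont_at l D (fun m _ => brow m j).
Proof.
rewrite (_ : (fun m _ => _) = (fun m (_ : T) =>
  BR 0 0 * U len m 0 j + BR 0 1 * U len m 1 j)); last first.
  by apply/funext => m; apply/funext => _; rewrite browE.
apply: unif_cont_atD; apply: unif_cont_atM.
- by apply: (unif_cont_at_cst _ (K := `|BR 0 0|)).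
- by apply: (U_unif_cont _ _ _ (p := fun=> len)).
- by apply: (unif_cont_at_cst _ (K := `|BR 0 1|)).
- by apply: (U_unif_cont _ _ _ (p := fun=> len)).
Qed.

Lemma wrow_unif_cont l (T : Type) (D : set T) (p : T -> R) :
  (forall t, D t -> p t \in `[0, len]) ->
  unif_cont_at l D (fun m t => wrow m (p t)).
Proof.
move=> hp; apply: unif_cont_atD; apply: unif_cont_atM; try exact: brow_unif_cont.
- by apply: unif_cont_atN; exact: U_unif_cont.
- exact: U_unif_cont.
Qed.

(** The difference quotient of E at l; its value at m = l is E'(l). *)
Let slope l m := eps * \int[mu]_(y in I) (wrow l y * phi m y).

Lemma slope_cvg l : slope l m @[m --> l] --> slope l l.
Proof.
apply: cvgM; first exact: cvg_cst.
have [K K0 hK] := within_continuous_bounded (@wrow_continuous l).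
apply: (@unif_cont_at_cvg R l setT (fun m _ => \int[mu]_(y in I) (wrow l y * phi m y)) 0) => //.
apply: (@unif_cont_at_Rintegral R l R setT len (fun m _ y => wrow l y * phi m y)) => //.
- move=> m t _; apply: continuous_integrable => x.
  by apply: cvgM; [exact: wrow_continuous|exact: phi_continuous].
- apply: unif_cont_atM.
    by apply: (unif_cont_at_cst _ (K := K)) => -[t y] [_ yI]; exact: hK.
  by apply: phi_unif_cont => -[t y] [].
Qed.

(** * The Green function and the weight *)

(** The upper right entry of U(x) U^-1(y). *)
Let kern m (p : R * R) := U p.1 m 0 1 * U p.2 m 0 0 - U p.1 m 0 0 * U p.2 m 0 1.

(** The closed form of the Green function on the square; on the diagonal the two
branches agree, since kern vanishes there. *)
Let green m (p : R * R) := (if p.2 < p.1 then 1 else 0) * (Evans len BR NL U m * kern m p) -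
  phi m p.1 * wrow m p.2.

Let square := [set p : R * R | I p.1 /\ p.2 \in `[0, len]].

Lemma GreenE m x y : x \in `[0, len] -> y \in `[0, len] ->
  Green len BR NL U x y m = green m (x, y).
Proof.
move=> xI yI; have [i00 i01 i10 i11] := invmx2 (U_det m yI).
have PE i j : Pmx len BR NL U m i j = NL i 0 * brow m j.
  by rewrite /Pmx -mulmxA mxE big_ord1.
have UP j : (U x m *m Pmx len BR NL U m) 0 j = phi m x * brow m j.
  by rewrite mxE sum_ord2 !PE /phi; ring.
have K : (U x m *m Pmx len BR NL U m *m invmx (U y m)) 0 1 = phi m x * wrow m y.
  by rewrite mxE sum_ord2 !UP i01 i11 /wrow /coef /=; ring.
rewrite /Green /Gmx /green/=; case: ifPn => yx.
- rewrite mulmxBr mulmxBl [LHS]mxE [X in _ + X]mxE K mul1r; congr (_ - _).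
  by rewrite mul_mx_scalar -scalemxAl mxE mxE sum_ord2 i01 i11 /kern/=; ring.
- by rewrite mxE K mul0r sub0r.
Qed.

Lemma green_unif_cont l : unif_cont_at l square green.
Proof.
have p1 t : square t -> t.1 \in `[0, len] by case.
have p2 t : square t -> t.2 \in `[0, len] by case.
apply: unif_cont_atB; apply: unif_cont_atM.
- apply: (unif_cont_at_cst _ (K := 1)) => t _.
  by case: ifP => _; rewrite ?normr1 ?normr0.
- apply: unif_cont_atM.
    rewrite (_ : (fun m _ => _) = (fun m (_ : R * R) =>
      brow m 0 * NL 0 0 + brow m 1 * NL 1 0)); last first.
      by apply/funext => m; apply/funext => _; rewrite EvansE.
    apply: unif_cont_atD; apply: unif_cont_atM; try exact: brow_unif_cont.
    + by apply: (unif_cont_at_cst _ (K := `|NL 0 0|)).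
    + by apply: (unif_cont_at_cst _ (K := `|NL 1 0|)).
  by apply: unif_cont_atB; apply: unif_cont_atM; exact: U_unif_cont.
- exact: phi_unif_cont.
- exact: wrow_unif_cont.
Qed.

Lemma green_sqr_unif_cont l : unif_cont_at l square (fun m p => green m p ^+ 2).
Proof. by apply: unif_cont_atM; exact: green_unif_cont. Qed.

Lemma green_sqr_bounded m : exists K : R, forall x y, x \in `[0, len] ->
  y \in `[0, len] -> `|green m (x, y) ^+ 2| <= K.
Proof.
have [[K hK] _] := green_sqr_unif_cont m.
by exists K => x y xI yI; apply: hK.
Qed.

(** The entries of U extended by zero outside [0, len], where U is arbitrary. *)
Let Uz m i j : R -> R := (fun x => U x m i j) \_ I.

Lemma measurable_Uz m i j : measurable_fun setT (Uz m i j).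
Proof.
apply/(measurable_restrictT _ _).1 => //.
by apply: subspace_continuous_measurable_fun => //; exact: U_continuous.
Qed.

(** The closed form of the Green function with U extended by zero: it is measurable
on the whole plane, and vanishes when y is outside [0, len]. *)
Let greenz m (p : R * R) :=
  (if p.2 < p.1 then 1 else 0) *
    (Evans len BR NL U m * (Uz m 0 1 p.1 * Uz m 0 0 p.2 - Uz m 0 0 p.1 * Uz m 0 1 p.2)) -
  (Uz m 0 0 p.1 * NL 0 0 + Uz m 0 1 p.1 * NL 1 0) *
    (brow m 0 * (- Uz m 0 1 p.2) + brow m 1 * Uz m 0 0 p.2).

Lemma greenz_in m x y : x \in `[0, len] -> y \in `[0, len] ->
  greenz m (x, y) = green m (x, y).
Proof. by move=> xI yI; rewrite /greenz /Uz /= !patchE !mem_set. Qed.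

Lemma greenz_out m x y : y \notin `[0, len] -> greenz m (x, y) = 0.
Proof.
move=> yI; have Uz0 i j : Uz m i j y = 0.
  by rewrite /Uz patchE memNset//= => yI'; rewrite yI' in yI.
by rewrite /greenz /= !Uz0; ring.
Qed.

Lemma measurable_greenz_sqr m :
  measurable_fun setT (fun p : measurableTypeR R * measurableTypeR R => greenz m p ^+ 2).
Proof.
apply: measurable_funX.
have m1 i j : measurable_fun setT
    (fun p : measurableTypeR R * measurableTypeR R => Uz m i j p.1).
  by apply: (measurableT_comp (measurable_Uz m i j)); exact: measurable_fst.
have m2 i j : measurable_fun setT
    (fun p : measurableTypeR R * measurableTypeR R => Uz m i j p.2).
  by apply: (measurableT_comp (measurable_Uz m i j)); exact: measurable_snd.
apply: measurable_funB; apply: measurable_funM.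
- apply: measurable_fun_ifT => //.
  by apply: measurable_fun_ltr; [exact: measurable_snd|exact: measurable_fst].
- apply: measurable_funM => //.
  by apply: measurable_funB; apply: measurable_funM.
- by apply: measurable_funD; apply: measurable_funM.
- by apply: measurable_funD; apply: measurable_funM => //; exact: measurableT_comp.
Qed.

Lemma bounded_integrable (f : R -> R) (K : R) : measurable_fun I f ->
  (forall x, x \in `[0, len] -> `|f x| <= K) -> mu.-integrable I (EFin \o f).
Proof.
move=> mf fK; apply: measurable_bounded_integrable => //.
- by rewrite [X in (X < _)%E](mu_itv0 len_gt0) ltry.
- exists K; split; first exact: num_real.
  by move=> M KM x xI /=; apply: le_trans (ltW KM); exact: fK.
Qed.

Lemma green_sqr_integrable m x : x \in `[0, len] ->
  mu.-integrable I (EFin \o (fun y => green m (x, y) ^+ 2)).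
Proof.
move=> xI; have [K hK] := green_sqr_bounded m.
apply: (@bounded_integrable _ K) => [|y yI]; last exact: hK.
apply: (@eq_measurable_fun _ _ _ _ I (fun y => greenz m (x, y) ^+ 2)).
  by move=> y; rewrite inE => yI; rewrite greenz_in.
apply: measurable_funTS.
exact: (measurableT_comp (measurable_greenz_sqr m) (@pair1_measurable _ _ _ _ x)).
Qed.

(** The inner integral in the square of the weight. *)
Let inner m x := \int[mu]_(y in I) (green m (x, y) ^+ 2).

(** Measurability of the inner integral is Tonelli's theorem for [greenz]. *)
Lemma inner_integrable m : mu.-integrable I (EFin \o inner m).
Proof.
have [K hK] := green_sqr_bounded m.
apply: (@bounded_integrable _ (K * len)) => [|x xI]; last first.
  apply: le_trans (le_normr_Rintegral _ (green_sqr_integrable m xI)) _ => //.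
  rewrite -(Rintegral_cst_itv0 len_gt0); apply: le_Rintegral => //.
  - by apply: integrable_normr => //; exact: green_sqr_integrable.
  - exact: integrable_cst_itv0.
  - by move=> y yI; exact: hK.
apply: (@eq_measurable_fun _ _ _ _ I
    (fun x => fine (\int[mu]_y (greenz m (x, y) ^+ 2)%:E))).
  move=> x; rewrite inE => xI; rewrite /inner Rintegral_mkcond; congr fine.
  apply: eq_integral => y _; rewrite patchE.
  case: ifPn => [|/negP yI]; first by rewrite inE => yI; rewrite greenz_in.
  rewrite greenz_out ?expr0n//; apply/negP => yI'; apply: yI.
  by rewrite inE.
apply: measurable_funTS.
apply: (measurableT_comp (fine_measurable measurableT)).
apply: (measurable_fun_fubini_tonelli_F (m2 := mu)
  (fun p : measurableTypeR R * measurableTypeR R => (greenz m p ^+ 2)%:E)).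
- by apply/measurable_EFinP; exact: measurable_greenz_sqr.
- by move=> p; rewrite lee_fin sqr_ge0.
Qed.

Lemma weightE m : weight len BR NL U m = Num.sqrt (\int[mu]_(x in I) inner m x).
Proof.
congr Num.sqrt; apply: eq_Rintegral => x; rewrite inE => xI.
by apply: eq_Rintegral => y; rewrite inE => yI; rewrite GreenE.
Qed.

Lemma weight_cvg l : weight len BR NL U m @[m --> l] --> weight len BR NL U l.
Proof.
rewrite (_ : weight _ _ _ _ = fun m => Num.sqrt (\int[mu]_(x in I) inner m x)); last first.
  by apply/funext => m; exact: weightE.
have main : \int[mu]_(x in I) inner m x @[m --> l] --> \int[mu]_(x in I) inner l x;
  last exact: (cvg_comp _ _ main (@sqrt_continuous R _)).
apply: (@unif_cont_at_cvg R l setT (fun m _ => \int[mu]_(x in I) inner m x) 0) => //.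
apply: (@unif_cont_at_Rintegral R l R setT len (fun m _ x => inner m x)) => //.
  by move=> m t _; exact: inner_integrable.
have H : unif_cont_at l I inner.
  apply: (@unif_cont_at_Rintegral R l R I len (fun m x y => green m (x, y) ^+ 2)) => //.
    by move=> m x xI; exact: green_sqr_integrable.
  have [[K hK] h] := green_sqr_unif_cont l.
  split; first by exists K => -[x y] xyI; exact: hK.
  by move=> e /h; apply: filterS => m hm -[x y] xyI; exact: hm.
have [[K hK] h] := H; split; first by exists K => -[x y] [_ yI]; exact: hK.
by move=> e /h; apply: filterS => m hm -[x y] [_ yI]; exact: hm.
Qed.

Hypothesis BR_unit : BR *m BR^T = 1%:M.
Hypothesis NL_neq0 : NL != 0.

Lemma NL_norm_gt0 : 0 < NL 0 0 ^+ 2 + NL 1 0 ^+ 2.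
Proof.
rewrite lt_neqAle addr_ge0 ?sqr_ge0// andbT eq_sym.
apply: contra NL_neq0; rewrite paddr_eq0 ?sqr_ge0// !sqrf_eq0 => /andP[/eqP h0 /eqP h1].
by apply/eqP/matrixP => i j; rewrite (ord1 j) mxE; case: (ord2P i) => ->.
Qed.

(** * The derivative of E / W *)

(** If E = 0, the row B_R M is orthogonal to N_L, hence a multiple c of
(- N_L2, N_L1); c is not zero because B_R is not zero and M is invertible. *)
Lemma wrow_proportional l : Evans len BR NL U l = 0 ->
  exists2 c, c != 0 & forall y, wrow l y = c * phi l y.
Proof.
rewrite EvansE => E0.
have N0 := NL_norm_gt0.
pose c := (brow l 1 * NL 0 0 - brow l 0 * NL 1 0) / (NL 0 0 ^+ 2 + NL 1 0 ^+ 2).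
have cN : c * (NL 0 0 ^+ 2 + NL 1 0 ^+ 2) = brow l 1 * NL 0 0 - brow l 0 * NL 1 0.
  by rewrite /c divfK// lt0r_neq0.
have b0 : brow l 0 = - c * NL 1 0.
  apply: (mulIf (lt0r_neq0 N0)); rewrite mulrAC !mulNr cN.
  rewrite -[LHS]subr0 -[X in _ - X](mulr0 (NL 0 0)) -E0; ring.
have b1 : brow l 1 = c * NL 0 0.
  apply: (mulIf (lt0r_neq0 N0)); rewrite mulrAC cN.
  rewrite -[LHS]subr0 -[X in _ - X](mulr0 (NL 1 0)) -E0; ring.
exists c; last by move=> y; rewrite /wrow b0 b1 /coef /phi /=; ring.
apply/eqP => c0; rewrite c0 oppr0 !mul0r in b0 b1.
have e0 : BR 0 0 = brow l 0 * U len l 1 1 - brow l 1 * U len l 1 0.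
  by rewrite -[LHS]mulr1 -(U_det l len_in) !browE; ring.
have e1 : BR 0 1 = brow l 1 * U len l 0 0 - brow l 0 * U len l 0 1.
  by rewrite -[LHS]mulr1 -(U_det l len_in) !browE; ring.
have /matrixP/(_ 0 0) := BR_unit.
rewrite !mxE sum_ord2 !mxE e0 e1 b0 b1 !mul0r !subrr !mul0r addr0 /= => /eqP.
by rewrite eq_sym oner_eq0.
Qed.

(** The squared L_2 norm of phi. *)
Let energy l := \int[mu]_(y in I) (phi l y ^+ 2).

Lemma phi_sqr_continuous l : {within I, continuous (fun y => phi l y ^+ 2)}.
Proof. by move=> x; apply: cvgM; exact: phi_continuous. Qed.

Lemma phi_sqr_integrable l : mu.-integrable I (EFin \o (fun y => phi l y ^+ 2)).
Proof. by apply: continuous_integrable; exact: phi_sqr_continuous. Qed.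

Lemma energy_ge0 l : 0 <= energy l.
Proof. by apply: Rintegral_ge0 => x _; rewrite sqr_ge0. Qed.

Lemma energy_eq0_ae l : energy l = 0 ->
  {ae mu, forall x, x \in `[0, len] -> phi l x = 0}.
Proof.
move=> J0; have hi := phi_sqr_integrable l.
have : ae_eq mu I (EFin \o (fun y => phi l y ^+ 2)) (cst 0%E).
  apply/ae_eq_integral_abs => //; first by case/integrableP: hi.
  under eq_integral => x _ do rewrite /= ger0_norm ?sqr_ge0//.
  rewrite -[LHS]fineK; first by rewrite -/(Rintegral _ _ _) -/(energy l) J0.
  exact: integrable_fin_num.
apply: ae_imp => x h xI; have /eqP := h xI.
by rewrite /= eqe sqrf_eq0 => /eqP.
Qed.

Hypothesis L_witness_unique : witness_unique len eps A0 BL BR.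

(** If phi were zero almost everywhere, U N_L and 0 would be two witnesses for
the zero function. *)
Lemma energy_gt0 l : Evans len BR NL U l = 0 -> 0 < energy l.
Proof.
move=> E0; rewrite lt_neqAle energy_ge0 andbT eq_sym; apply/negP => /eqP/energy_eq0_ae phi0.
pose psi y := U y l 1 0 * NL 0 0 + U y l 1 1 * NL 1 0.
pose u y : 'cV[R[i]]_2 := \col_i (if i == 0 then phi l y else psi y)%:C%C.
pose z (x : R) : R[i] := 0.
have u0 y : u y 0 0 = (phi l y)%:C%C by rewrite mxE.
have u1 y : u y 1 0 = (psi y)%:C%C by rewrite mxE.
have zL : inL2 len z by apply: continuous_inL2 => x; exact: cvg_cst.
have cst_ac c : abs_cont 0 len (fun=> c).
  by apply: (@abs_cont_lipschitz _ _ _ _ 0) => x y _ _; rewrite subrr normr0 mul0r.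
have U_ac i : abs_cont 0 len (fun y => U y l i 0 * NL 0 0 + U y l i 1 * NL 1 0).
  by apply: abs_contD; apply: abs_contM; rewrite ?ltW//; exact: U_abs_cont.
have wu : operator_witness len eps A0 BL BR z z u.
  split.
  - move=> k; apply/abs_continuousP.
    case: (ord2P k) => ->; split.
    + by under eq_fun do rewrite u0; exact: (U_ac 0).
    + by under eq_fun do rewrite u0; exact: cst_ac.
    + by under eq_fun do rewrite u1; exact: (U_ac 1).
    + by under eq_fun do rewrite u1; exact: cst_ac.
  - by move: phi0; apply: ae_imp => x h xI; rewrite u0 h.
  - move: phi0; apply: ae_imp => x h xI; apply/has_cderiv_inP => //.
    have U0 j := U_rderiv_row0 l j xI; have U1 j := U_rderiv_row1 l j xI.
    have cd := rderiv_cst 0 len _ x.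
    split.
    + under eq_fun do rewrite u0; rewrite u0 u1 /=.
      have := rderivD (rderivM (U0 0) (cd (NL 0 0))) (rderivM (U0 1) (cd (NL 1 0))).
      by congr rderiv; rewrite /phi /psi; ring.
    + under eq_fun do rewrite u0; rewrite u0 u1 /= !mulr0 addr0; exact: cd.
    + under eq_fun do rewrite u1; rewrite u0 u1 /=.
      have := rderivD (rderivM (U1 0) (cd (NL 0 0))) (rderivM (U1 1) (cd (NL 1 0))).
      congr rderiv.
      transitivity (A0 x 1 0 * phi l x - A0 x 0 0 * psi x + eps * l * phi l x).
        by rewrite /phi /psi; ring.
      by rewrite (h xI) !mulr0.
    + rewrite [X in rderiv _ _ _ _ X](_ : _ = 0); last by rewrite u0 u1 /=; ring.
      by apply: eq_rderiv (cd 0) => // t _; rewrite u1.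
  - apply/to_cmx_mul0; rewrite u0 u1 /= /phi /psi; have [-> -> -> ->] := U_init l.
    by rewrite !mul1r !mul0r addr0 add0r BL_NL !mulr0 addr0.
  - apply/to_cmx_mul0; rewrite u0 u1 /= !mulr0 addr0; split => //.
    by rewrite -[RHS]E0 EvansE !browE /phi /psi; ring.
have wz : operator_witness len eps A0 BL BR z z (fun=> 0).
  split.
  - move=> k; apply/abs_continuousP.
    by split; exact: cst_ac.
  - by apply: aeW => x _; rewrite mxE.
  - apply: aeW => x xI; apply/has_cderiv_inP => //.
    by rewrite !mxE /= !mulr0 subr0 !addr0; split; exact: rderiv_cst.
  - by rewrite mulmx0.
  - by rewrite mulmx0.
have /matrixP H := L_witness_unique zL zL zL wu wz zero_in.
have := H 0 0; have := H 1 0; rewrite u0 u1 !mxE /phi /psi.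
have [-> -> -> ->] := U_init l; rewrite !mul1r !mul0r addr0 add0r => -[h1] [h0].
by have := NL_norm_gt0; rewrite h0 h1 expr0n /= addr0 ltxx.
Qed.

Lemma slope_weight l : Evans len BR NL U l = 0 ->
  weight len BR NL U l != 0 /\
  (slope l l / weight len BR NL U l = 1 \/ slope l l / weight len BR NL U l = -1).
Proof.
move=> E0; have [c c0 wc] := wrow_proportional E0; have J0 := energy_gt0 E0.
have hi := phi_sqr_integrable l.
have innerE x : inner l x = c ^+ 2 * energy l * phi l x ^+ 2.
  transitivity (\int[mu]_(y in I) ((c * phi l x) ^+ 2 * phi l y ^+ 2)).
    by apply: eq_Rintegral => y _; rewrite /green E0 /= wc; ring.
  by rewrite RintegralZl// -/(energy l); ring.
have WE : weight len BR NL U l = `|c| * energy l.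
  rewrite weightE; under eq_Rintegral do rewrite innerE.
  rewrite RintegralZl// -/(energy l).
  rewrite (_ : _ * _ = (c * energy l) ^+ 2); last by ring.
  by rewrite sqrtr_sqr normrM (gtr0_norm J0).
have SE : slope l l = eps * c * energy l.
  rewrite /slope -[RHS]mulrA; congr (_ * _); rewrite /energy -RintegralZl//.
  by apply: eq_Rintegral => y _; rewrite wc; ring.
have J1 := lt0r_neq0 J0; have c1 : `|c| != 0 by rewrite normr_eq0.
split; first by rewrite WE mulf_neq0.
rewrite SE WE -mulf_div divff// mulr1.
have [cp|cn] := ltP 0 c.
- rewrite gtr0_norm// mulfK//; exact: eps_pm1.
- rewrite ler0_norm// invrN mulrN mulfK//.
  by case: eps_pm1 => ->; [right|left; rewrite opprK].
Qed.

Lemma is_derive_Evans_div_weight l : Evans len BR NL U l = 0 ->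
  (\forall m \near l, weight len BR NL U m != 0) /\
  is_derive l 1 (fun m => Evans len BR NL U m / weight len BR NL U m)
    (slope l l / weight len BR NL U l).
Proof.
move=> E0; have [W0 _] := slope_weight E0.
have cW := @weight_cvg l.
split; first exact: cvgr_neq0 cW W0.
rewrite (_ : (fun m => _) = fun m => (m - l) * (slope l m / weight len BR NL U m)).
  by apply: is_derive_mul_sub; apply: cvgM; [exact: slope_cvg|exact: cvgV].
apply/funext => m; rewrite mulrA; congr (_ / _).
by rewrite /slope -Evans_sub E0 subr0.
Qed.

Lemma Evans_div_weight_derivative l : operator_spectrum len eps A0 BL BR l%:C ->
  (\forall m \near l, weight len BR NL U m != 0) /\
  (is_derive l 1 (fun m : R => Evans len BR NL U m / weight len BR NL U m) 1 \/
   is_derive l 1 (fun m : R => Evans len BR NL U m / weight len BR NL U m) (-1)).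
Proof.
move=> /spectrum_Evans_eq0 E0.
have [nW dW] := is_derive_Evans_div_weight E0; split => //.
by have [_ [e|e]] := slope_weight E0; rewrite e in dW; [left|right].
Qed.

End EvansFunction.

Lemma smooth_in_continuous (R : realType) (a b : R) (m n : nat)
    (A : R -> 'M[R]_(m, n)) : smooth_in `[a, b] A ->
  forall i j, {within `[a, b], continuous (fun x => A x i j)}.
Proof.
move=> [F [F0 FD]] i j.
apply: (@rderiv_continuous _ a b _ (fun x => F 1%N x i j)) => x xI.
have /has_deriv_in_mxP/(_ i j) := FD 0%N x xI.
by apply: eq_rderiv => // t tI; rewrite F0.
Qed.

Unset Implicit Arguments.

Theorem theorem2p4 (R : realType) (len eps : R) (A0 : R -> 'M[R]_2)
    (BL BR : 'rV[R]_2) (NL : 'cV[R]_2) (U : R -> R -> 'M[R]_2)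
    (len_gt0 : 0 < len)
    (eps_pm1 : eps = 1 \/ eps = -1)
    (A0_smooth : smooth_in `[0, len] A0)
    (A0_trace : forall x : R, x \in `[0, len] -> \tr (A0 x) = 0)
    (BL_unit : BL *m BL^T = 1%:M)
    (BR_unit : BR *m BR^T = 1%:M)
    (L_witness_unique : witness_unique len eps A0 BL BR)
    (L_compact_resolvent : has_compact_resolvent len eps A0 BL BR)
    (NL_neq0 : NL != 0)
    (NL_span : forall v : 'cV[R]_2,
       BL *m v = 0 <-> exists c : R, v = c *: NL)
    (U_fundamental : fundamental_matrix len eps A0 U) :
  forall l : R, operator_spectrum len eps A0 BL BR l%:C ->
    (\forall m \near l, weight len BR NL U m != 0) /\
    (is_derive l 1 (fun m : R => Evans len BR NL U m / weight len BR NL U m) 1 \/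
     is_derive l 1 (fun m : R => Evans len BR NL U m / weight len BR NL U m) (-1)).
Proof.
move=> l; apply: Evans_div_weight_derivative => //.
exact: smooth_in_continuous.
Qed.
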